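(* Let $k,m,n$ be integers with $1\le k\le\min(m,n)$. The moment generating function $F_{k,m,n}(t)=\mathbb{E}\left[\exp(t\cdot C_{k,m,n})\right]$ can be written $$F_{k,m,n}(t)=\frac{P(t)}{Q(t)},$$ where $P(t)$ and $Q(t)$ are polynomials of degree $\binom{k}{2}$ and $\binom{k+1}{2}$ respectively, and $$Q(t)=\prod_{\substack{i,j\ge0\\ i+j<k}}\left(1-\frac{(k-i-j)\cdot t}{(m-i)(n-j)}\right).$$
   Context: In the complete bipartite graph with vertex sets of sizes $m$ and $n$, the $mn$ edges are assigned independent exponentially distributed costs of mean $1$. A $k$-matching is a set of $k$ edges no two of which share a vertex; its cost is the sum of its edge costs. $C_{k,m,n}$ denotes the minimum cost of a $k$-matching. The polynomials $P$ and $Q$ are not required to be relatively prime. *)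

(* Defs.v *)
From mathcomp Require Import all_boot all_order all_algebra.
From mathcomp Require Import all_classical all_reals all_analysis.

Set Implicit Arguments.
Unset Strict Implicit.
Unset Printing Implicit Defensive.

Import Order.TTheory GRing.Theory Num.Theory.

Local Open Scope classical_set_scope.
Local Open Scope ring_scope.

Section RandomCosts.
Context d (T : measurableType d) (R : realType) (Pr : probability T R).

Definition mutually_independent (I : finType) (X : I -> {RV Pr >-> R}) : Prop :=
  forall (J : {set I}) (A : I -> set R),
    (forall i, i \in J -> measurable (A i)) ->
    Pr (\bigcap_(i in [set` J]) (X i @^-1` A i)) =
    (\prod_(i in J) Pr (X i @^-1` A i))%E.

(* [exponential_prob] takes the rate as parameter; the mean is its inverse.  It
   is the exponential law on measurable sets only. *)
Definition exponentially_distributed (mean : R) (X : {RV Pr >-> R}) : Prop :=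
  forall A : set R, measurable A ->
    distribution Pr X A = exponential_prob mean^-1 A.

End RandomCosts.

Section Matchings.
Variables (R : realType) (m n : nat).

(* The edge set of the complete bipartite graph is ['I_m * 'I_n]. *)
Definition is_k_matching (k : nat) (M : {set 'I_m * 'I_n}) : bool :=
  (#|M| == k) &&
  [forall e in M, forall f in M,
     (e != f) ==> (e.1 != f.1) && (e.2 != f.2)].

Definition matching_cost (c : 'I_m * 'I_n -> R) (M : {set 'I_m * 'I_n}) : R :=
  \sum_(e in M) c e.

(* The infimum is over a finite set, nonempty when [k <= minn m n]; it is then
   attained, see [min_matching_costP]. *)
Definition min_matching_cost (k : nat) (c : 'I_m * 'I_n -> R) : R :=
  inf [set matching_cost c M | M in [set M | is_k_matching k M]].

Lemma exists_k_matching (k : nat) :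
  (k <= minn m n)%N -> exists M, is_k_matching k M.
Proof.
rewrite leq_min => /andP[km kn].
pose f (i : 'I_k) := (widen_ord km i, widen_ord kn i).
have f_inj : injective f by move=> i j fij; apply: val_inj; case: fij.
exists [set f i | i in 'I_k]%SET; apply/andP; split.
  by rewrite card_imset// card_ord.
apply/forall_inP => _ /imsetP[i _ ->]; apply/forall_inP => _ /imsetP[j _ ->].
by apply/implyP; rewrite (inj_eq f_inj) -!val_eqE /= => ->.
Qed.

Lemma min_matching_costP (k : nat) (c : 'I_m * 'I_n -> R) :
  (k <= minn m n)%N ->
  (exists2 M, is_k_matching k M & min_matching_cost k c = matching_cost c M) /\
  (forall M, is_k_matching k M -> min_matching_cost k c <= matching_cost c M).
Proof.
move=> /exists_k_matching[M0 M0k].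
case: (@arg_minP _ _ _ M0 (is_k_matching k) (matching_cost c) M0k) => M Mk Mmin.
suff -> : min_matching_cost k c = matching_cost c M by split; [exists M|].
apply/eqP; rewrite eq_le; apply/andP; split.
  apply: ge_inf; last by exists M.
  by exists (matching_cost c M) => _ [N Nk <-]; exact: Mmin.
apply: lb_le_inf; first by exists (matching_cost c M), M.
by move=> _ [N Nk <-]; exact: Mmin.
Qed.

(* All the natural number subtractions are exact when [k <= minn m n]. *)
Definition mgf_denominator (k : nat) : {poly R} :=
  \prod_(i < k) \prod_(j < k | (i + j < k)%N)
    (1 - ((k - i - j)%:R / ((m - i)%:R * (n - j)%:R)) *: 'X).

End Matchings.
Arguments mgf_denominator : clear implicits.

(* Main.v *)
(** Egervary's duality writes a cost matrix [c], with minimum [k]-matching cost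
    [C c], as a nonnegative combination of matrix units and of indicators of
    the edges missed by covers [(A, B)], where [A] is a set of rows and [B] a
    set of columns.  A matrix unit adds 1 to the sum of the entries and 0 to
    [C]; the indicator of a cover with [#|A| = i] and [#|B| = j] adds
    [(m - i)(n - j)] to the sum and [k - i - j] to [C].  Taking the least
    optimal dual solution makes the combination unique, and whether a
    combination is the canonical one depends only on its support.  So the
    integer points of the cost orthant are the disjoint union of the relative
    interiors of finitely many unimodular cones, and the covers in each cone
    form a chain, hence have distinct pairs [(i, j)].

    Rounding the costs to a grid of mesh [h] makes them geometric, and the
    moment generating function becomes a sum of products of geometric series,
    one for each cone.  As [h] tends to 0 only the cones of full dimension
    survive, each giving a product of factors
    [1 / ((m - i)(n - j) - t (k - i - j))] with distinct pairs [(i, j)]; this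
    has the denominator [Q].  The degree of the numerator follows because
    [F(-s)] is of the order of [s ^- k] when [s] tends to infinity. *)

Require Import Defs.
From mathcomp Require Import all_boot all_order all_fingroup all_algebra.
From mathcomp Require Import boolp.
From mathcomp Require Import zify ring lra.

Set Implicit Arguments.
Unset Strict Implicit.
Unset Printing Implicit Defensive.

Import Order.TTheory GRing.Theory Num.Theory.
Local Open Scope ring_scope.

(** * Assignment duality *)

Section Potential.
Variables (R : realDomainType) (V : finType) (l : V -> V -> R).

Fixpoint walk_weight x s :=
  if s is y :: s' then l x y + walk_weight y s' else 0.

Lemma walk_weight_cat x s1 s2 :
  walk_weight x (s1 ++ s2) = walk_weight x s1 + walk_weight (last x s1) s2.
Proof. by elim: s1 x => [|y s1 IH] x /=; rewrite ?add0r// IH addrA. Qed.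

(* The potential of [y] is the least weight of a simple walk from [r] to [y]. *)
Lemma potential_exists :
  (forall x s, uniq (x :: s) -> 0 <= walk_weight x s + l (last x s) x) ->
  exists p : V -> R, forall x y, p y <= p x + l x y.
Proof.
move=> cyc; have [r _|V0] := pickP (@predT V); last first.
  by exists (fun=> 0) => x; have := V0 x.
pose P v (s : #|V|.-bseq V) := uniq (r :: s) && (last r s == v).
have sizeP s : uniq (r :: s) -> (size s <= #|V|)%N.
  by move=> /card_uniqP us; rewrite ltnW// -[X in (X <= _)%N]us max_card.
have exP v : exists s, P v s.
  have [->|rv] := eqVneq v r; first by exists [bseq]; rewrite /P /= eqxx.
  have us : uniq [:: r; v] by rewrite /= inE eq_sym rv.
  by exists (Bseq (sizeP [:: v] us)); rewrite /P us /= eqxx.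
pose s0 v := xchoose (exP v).
pose s v := [arg min_(s < s0 v | P v s) walk_weight r s]%O.
have sP v : P v (s v) /\ forall s', P v s' -> walk_weight r (s v) <= walk_weight r s'.
  by rewrite /s; case: Order.TotalTheory.arg_minP; first exact: xchooseP.
exists (fun v => walk_weight r (s v)) => x y.
have [/andP[us /eqP lx] _] := sP x; have [_ smin] := sP y.
have smin' s' : uniq (r :: s') -> last r s' = y ->
    walk_weight r (s y) <= walk_weight r s'.
  by move=> us' ls'; apply: (smin (Bseq (sizeP _ us'))); rewrite /P us' ls' /=.
have [yin|ynin] := boolP (y \in r :: s x); last first.
  have us' : uniq (r :: rcons (s x) y) by rewrite -rcons_cons rcons_uniq ynin.
  have := smin' _ us' (last_rcons _ _ _).
  by rewrite -cats1 walk_weight_cat lx /= addr0.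
(* When [y] already lies on the walk to [x], the portion after [y] and the step from [x] back to [y]
   form a simple cycle, of nonnegative weight. *)
move: yin; rewrite inE => /predU1P[yr|yin].
  rewrite (le_trans (smin' [::] _ _))//=; have := cyc r (s x) us.
  by rewrite yr lx.
move: us lx; case/splitPr: yin => s1 s2 us lx.
have us1 : uniq (r :: rcons s1 y).
  by move: us; rewrite -cat_cons -cat_rcons cat_uniq rcons_cons => /andP[].
have us2 : uniq (y :: s2).
  by move: us; rewrite -cat_cons cat_uniq => /and3P[].
rewrite (le_trans (smin' (rcons s1 y) us1 (last_rcons _ _ _)))//.
rewrite -cat_rcons walk_weight_cat last_rcons -addrA lerDl.
have := cyc y s2 us2; suff -> : last y s2 = x by [].
by rewrite -lx last_cat.
Qed.

(** Advancing along the simple cycle and fixing all other points is a permutation. This lets the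
    optimality of a permutation exclude negative cycles. *)
Lemma cycle_perm x s : uniq (x :: s) ->
  exists tau : {perm V}, \sum_v l v (tau v) =
    walk_weight x s + l (last x s) x + \sum_(v | v \notin x :: s) l v v.
Proof.
move=> us.
have nextI : injective (next (x :: s)) by exact: can_inj (prev_next us).
exists (perm nextI); rewrite (bigID (mem (x :: s)))/=; congr (_ + _); last first.
  apply: eq_bigr => v vs; rewrite permE.
  by congr (l _ _); rewrite next_nth (negPf vs).
under eq_bigr do rewrite permE; rewrite -big_uniq//=.
have : forall y p y0, uniq (y :: p) ->
    \sum_(v <- y :: p) l v (next_at v y0 y p) = walk_weight y p + l (last y p) y0.
  move=> y p; elim: p y => [|y' p IH] y y0 /=.
    by rewrite big_seq1 eqxx add0r.
  move=> /andP[yp up]; rewrite big_cons /= eqxx -addrA; congr (_ + _).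
  rewrite -IH// big_seq [RHS]big_seq; apply: eq_bigr => v vp /=.
  by case: eqP => // vy; rewrite -vy vp in yp.
exact.
Qed.

End Potential.

(** Rotating an optimal permutation along a cycle cannot lower its cost, so the exchange graph has
    no negative cycle and carries a potential, which serves as the row dual. *)
Lemma assignment_duality (R : realDomainType) (V : finType) (a : V -> V -> R) :
  exists (sigma : {perm V}) (p q : V -> R),
    [/\ forall tau : {perm V}, \sum_i a i (sigma i) <= \sum_i a i (tau i),
        forall i j, q j <= p i + a i j &
        forall i, q (sigma i) = p i + a i (sigma i)].
Proof.
have [sigma _ opt] := @Order.TotalTheory.arg_minP _ _ _ (1%g : {perm V}) xpredT
  (fun s : {perm V} => \sum_i a i (s i)) isT.
(* The change in cost when the column of row [w] is handed over to row [v]. *)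
pose l v w := a v (sigma w) - a w (sigma w).
have [x s us|p pP] := @potential_exists _ _ l.
  have [tau tauE] := cycle_perm l us.
  suff : 0 <= \sum_v l v (tau v).
    rewrite tauE [X in _ + X]big1 ?addr0// => v _; exact: subrr.
  have := opt (tau * sigma)%g isT; rewrite -subr_ge0 /l sumrB.
  under eq_bigr do rewrite permM.
  by rewrite [X in 0 <= _ - X -> _](reindex_inj (@perm_inj _ tau)).
exists sigma, p, (fun j => p ((sigma^-1)%g j) + a ((sigma^-1)%g j) j).
split=> [tau|i j|i]; first exact: opt; last by rewrite permK.
have := pP i ((sigma^-1)%g j); rewrite /l permKV.
by rewrite addrA lerBrDr.
Qed.

(** * Duality for minimum-cost [k]-matchings *)

Section MatchingDuality.
Variables (m n k : nat).
Implicit Types (M : {set 'I_m * 'I_n}) (c : 'I_m * 'I_n -> nat).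

Lemma k_matchingP M : reflect
  [/\ #|M| = k, {in M &, injective fst} & {in M &, injective snd}]
  (is_k_matching k M).
Proof.
apply: (iffP andP) => [[/eqP cM /forall_inP H]|[cM h1 h2]]; split=> //.
- move=> e f eM fM /eqP ef; apply/eqP; apply: contraTT ef => ef.
  by have /forall_inP/(_ f fM)/implyP/(_ ef)/andP[] := H e eM.
- move=> e f eM fM /eqP ef; apply/eqP; apply: contraTT ef => ef.
  by have /forall_inP/(_ f fM)/implyP/(_ ef)/andP[] := H e eM.
- exact/eqP.
- apply/forall_inP => e eM; apply/forall_inP => f fM; apply/implyP => ef.
  by rewrite (contra_neq (h1 e f eM fM) ef) (contra_neq (h2 e f eM fM) ef).
Qed.

(* Pad the matrix to size [N = m + n - k] with [n - k] rows and [m - k] columns of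
   zeros, with a prohibitive cost [B] where a dummy row meets a dummy column.
   Cheapest permutations then restrict to cheapest [k]-matchings. *)
Lemma k_matching_duality c : (0 < k <= minn m n)%N ->
  exists M (x : 'I_m -> int) (y : 'I_n -> int) (lam : int),
  [/\ is_k_matching k M,
      [/\ forall i, 0 <= x i, forall j, y j <= lam &
          forall i j, y j - x i <= (c (i, j))%:Z],
      forall e, e \in M -> y e.2 - x e.1 = (c e)%:Z,
      forall i, i \notin [set e.1 | e in M] -> x i = 0 &
      forall j, j \notin [set e.2 | e in M] -> y j = lam].
Proof.
move=> /andP[k0]; rewrite leq_min => /andP[km kn].
pose N := (m + n - k)%N.
have mN : (m <= N)%N by rewrite /N; lia.
have nN : (n <= N)%N by rewrite /N; lia.
pose rI := widen_ord mN; pose cI := widen_ord nN.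
pose a0 (i j : 'I_N) : nat :=
  if insub (i : nat) is Some i' then
    if insub (j : nat) is Some j' then c (i', j') else 0%N
  else 0%N.
(* The reversal [rev_ord] sends no dummy row to a dummy column, and [B] is one more than its cost;
   hence an optimal permutation meets no dummy pair either. *)
pose B := (\sum_i a0 i (rev_ord i)).+1.
pose dd (i j : 'I_N) := (m <= i)%N && (n <= j)%N.
pose a (i j : 'I_N) : int := (a0 i j + B * dd i j)%N%:Z.
have [sigma [p [q [opt feas tight]]]] := assignment_duality a.
have nodd i : ~~ dd i (sigma i).
  apply/negP => ddi; have := opt (perm rev_ord_inj).
  apply/negP; rewrite -ltNge.
  rewrite [X in _ < X](bigD1 i)//= [X in X < _](_ : _ = B%:Z - 1).
    have -> : a i (sigma i) = (a0 i (sigma i) + B)%N%:Z by rewrite /a ddi muln1.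
    by rewrite ltr_wpDr ?sumr_ge0//; lia.
  under eq_bigr => j _.
    rewrite permE /a /dd /= (_ : _ && _ = false) ?muln0 ?addn0; last first.
      by apply/negbTE; have := ltn_ord j; rewrite /N; lia.
    over.
  by rewrite /B -addn1 PoszD addrK (big_morph Posz PoszD (erefl _)).
pose M : {set 'I_m * 'I_n} := [set e | sigma (rI e.1) == cI e.2].
have aE i j : a (rI i) (cI j) = (c (i, j))%:Z.
  rewrite /a /a0 /dd /= leqNgt ltn_ord /= muln0 addn0.
  rewrite (insubT (fun i => i < m)%N (ltn_ord i)) (insubT (fun j => j < n)%N (ltn_ord j)).
  by congr (Posz (c (_, _))); exact: val_inj.
have rI_inj : injective rI by move=> i i' /(congr1 val) /= /val_inj.
have cI_inj : injective cI by move=> i i' /(congr1 val) /= /val_inj.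
have rowP i : i \notin [set e.1 | e in M] -> (n <= sigma (rI i))%N.
  move=> iM; rewrite leqNgt; apply/negP => sn; case/negP: iM.
  apply/imsetP; exists (i, Ordinal sn) => //; rewrite inE; apply/eqP.
  exact: val_inj.
have colP j : j \notin [set e.2 | e in M] -> (m <= (sigma^-1)%g (cI j))%N.
  move=> jM; rewrite leqNgt; apply/negP => sm; case/negP: jM.
  apply/imsetP; exists (Ordinal sm, j) => //; rewrite inE /=; apply/eqP.
  by rewrite -[RHS](permKV sigma); congr (sigma _); exact: val_inj.
have M1 : {in M &, injective fst}.
  move=> [i j] [i' j'] /[!inE] /= /eqP e1 /eqP e2 ii'; subst i'.
  by congr (_, _); apply: cI_inj; rewrite -e1 -e2.
have M2 : {in M &, injective snd}.
  move=> [i j] [i' j'] /[!inE] /= /eqP e1 /eqP e2 jj'; subst j'.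
  by congr (_, _); apply: rI_inj; apply: (@perm_inj _ sigma); rewrite e1 e2.
(* The real rows and the rows sent to real columns together exhaust all [N] rows, so they share
   [m + n - N = k] of them. *)
have cardM : #|M| = k.
  pose A := [set i : 'I_N | (i < m)%N]; pose A' := [set j : 'I_N | (j < n)%N].
  have cA : #|A| = m.
    have -> : A = [set rI i | i : 'I_m].
      apply/setP => i; rewrite inE; apply/idP/imsetP => [im|[i' _ ->]];
        last by rewrite /= ltn_ord.
      by exists (Ordinal im) => //; exact: val_inj.
    by rewrite card_imset// card_ord.
  have cA' : #|sigma @^-1: A'| = n.
    have -> : A' = [set cI i | i : 'I_n].
      apply/setP => i; rewrite inE; apply/idP/imsetP => [im|[i' _ ->]];
        last by rewrite /= ltn_ord.
      by exists (Ordinal im) => //; exact: val_inj.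
    have -> : forall Z : {set 'I_N}, sigma @^-1: Z = (sigma^-1)%g @: Z.
      move=> Z; apply/setP => i; rewrite inE; apply/idP/imsetP => [iZ|[j jZ ->]].
        by exists (sigma i) => //; rewrite permK.
      by rewrite permKV.
    by rewrite (card_imset _ (@perm_inj _ _)) card_imset// card_ord.
  have AA' : A :|: sigma @^-1: A' = setT.
    apply/setP => i; rewrite !inE; have := nodd i.
    by rewrite /dd negb_and -!ltnNge => ->.
  have cAA : #|A :&: sigma @^-1: A'| = k.
    have := cardsUI A (sigma @^-1: A'); rewrite AA' cA cA' cardsT card_ord /N.
    lia.
  apply: etrans cAA; rewrite -(card_in_imset (f := fun e => rI e.1) (D := mem M)); last first.
    by move=> e f eM fM /rI_inj /(M1 _ _ eM fM).
  apply: eq_card => i; rewrite !inE; apply/imsetP/andP => [[e + ->]|[im sn]].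
    by rewrite inE => /eqP ->; split => /=.
  exists (Ordinal im, Ordinal sn); rewrite ?inE /=; last exact: val_inj.
  by apply/eqP; apply: val_inj => /=; congr (val (sigma _)); exact: val_inj.
have [e0 e0M] : exists e, e \in M by apply/card_gt0P; rewrite cardM.
(* Subtracting the least potential of a real row makes [x] nonnegative. Real rows matched to zero
   columns attain this minimum, and real columns matched to zero rows attain the maximum [y0]. *)
pose x0 := p (rI [arg min_(i < e0.1) p (rI i)]%O).
have x0P i : x0 <= p (rI i).
  by rewrite /x0; case: Order.TotalTheory.arg_minP => // i' _ /(_ i); exact.
have x0E : exists i, x0 = p (rI i) by eexists.
pose y0 := q (cI [arg max_(j > e0.2) q (cI j)]%O).
have y0P j : q (cI j) <= y0.
  by rewrite /y0; case: Order.TotalTheory.arg_maxP => // j' _ /(_ j); exact.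
have y0E : exists j, y0 = q (cI j) by eexists.
clearbody x0 y0.
exists M, (fun i => p (rI i) - x0), (fun j => q (cI j) - x0), (y0 - x0); split.
- exact/k_matchingP.
- split=> [i|j|i j]; rewrite ?subr_ge0 ?lerD2r//.
  by have := feas (rI i) (cI j); rewrite aE; lia.
- move=> e; rewrite inE => /eqP es; have := tight (rI e.1).
  by rewrite es aE -surjective_pairing; lia.
- move=> i /rowP si; have [i' x0e] := x0E.
  have := tight (rI i); have := feas (rI i') (sigma (rI i)); have := x0P i.
  have aI i1 : a (rI i1) (sigma (rI i)) = 0.
    rewrite /a /dd /a0 /= leqNgt ltn_ord /= muln0 addn0 insubT//= insubN//.
    by rewrite -leqNgt.
  by rewrite !aI; lia.
- move=> j /colP sj; have [j' y0e] := y0E.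
  have := tight ((sigma^-1)%g (cI j)); have := feas ((sigma^-1)%g (cI j)) (cI j').
  have := y0P j; rewrite permKV.
  have aI j1 : a ((sigma^-1)%g (cI j)) (cI j1) = 0.
    rewrite /a /dd /a0 /= [(n <= _)%N]leqNgt ltn_ord andbF muln0 addn0 insubN//.
    by rewrite -leqNgt.
  by rewrite !aI; lia.
Qed.

End MatchingDuality.

(** * Triangulation of the cost orthant *)

Section Triangulation.
Variables (m n k : nat).
Local Open Scope nat_scope.

Notation edge := ('I_m * 'I_n)%type.
Notation cover := ({set 'I_m} * {set 'I_n})%type.
Notation gen := (cover + edge)%type.
Implicit Types (M : {set edge}) (c d : edge -> nat) (u : {ffun gen -> nat}).
Implicit Types (x : 'I_m -> nat) (v : 'I_n -> nat) (U : {set gen}).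

Notation rows M := [set e.1 | e in (M : {set edge})].
Notation cols M := [set e.2 | e in (M : {set edge})].

Lemma sum_rows M x : is_k_matching k M ->
  \sum_i x i = \sum_(e in M) x e.1 + \sum_(i | i \notin rows M) x i.
Proof.
case/k_matchingP => _ M1 _; rewrite (bigID (mem (rows M)))/=; congr (_ + _).
by rewrite big_imset.
Qed.

Lemma sum_cols M v : is_k_matching k M ->
  \sum_j v j = \sum_(e in M) v e.2 + \sum_(j | j \notin cols M) v j.
Proof.
case/k_matchingP => _ _ M2; rewrite (bigID (mem (cols M)))/=; congr (_ + _).
by rewrite big_imset.
Qed.

(** Sum over the edges of [M], which use distinct rows and columns. With [d] the reduced cost, the
    last parenthesis is the gap between the cost of [M] and the dual value, [k * l] minus all the
    potentials, written without subtraction. *)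
Lemma matching_dual_gap M c d x v l : is_k_matching k M ->
    (forall e, e \in M -> c e + x e.1 + v e.2 = d e + l) ->
  \sum_(e in M) c e + \sum_i x i + \sum_j v j =
  k * l + (\sum_(e in M) d e + \sum_(i | i \notin rows M) x i
                             + \sum_(j | j \notin cols M) v j).
Proof.
move=> Mk cd; have [cM _ _] := k_matchingP _ _ Mk.
rewrite (sum_rows _ Mk) (sum_cols _ Mk).
have : \sum_(e in M) (c e + x e.1 + v e.2) = \sum_(e in M) (d e + l).
  exact: eq_bigr.
rewrite !big_split/= sum_nat_const cM; lia.
Qed.

(* Coordinates: [u (inl s)] is the weight of the indicator of the edges missed by
   the cover [s], [u (inr e)] that of the edge [e].  The row and column
   potentials and the level form the dual solution of the matching problem. *)
Definition row_potential u i := \sum_(s : cover | i \in s.1) u (inl s).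
Definition col_potential u j := \sum_(s : cover | j \in s.2) u (inl s).
Definition level u := \sum_(s : cover) u (inl s).
Definition slack u (e : edge) :=
  \sum_(s : cover | (e.1 \in s.1) && (e.2 \in s.2)) u (inl s) + u (inr e).
Definition cost_of u (e : edge) :=
  \sum_(s : cover | (e.1 \notin s.1) && (e.2 \notin s.2)) u (inl s) + u (inr e).

(** For each cover, missing the edge, containing its row and containing its column count 1 in all,
    plus 1 if both ends are covered. Thus [slack] is the reduced cost for these potentials. *)
Lemma cost_of_slack u e :
  cost_of u e + row_potential u e.1 + col_potential u e.2 = slack u e + level u.
Proof.
rewrite /cost_of /row_potential /col_potential /slack /level.
rewrite (bigID (fun s : cover => e.1 \in s.1) predT)/=.
rewrite (bigID (fun s : cover => e.2 \in s.2) (fun s => e.1 \in s.1))/=.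
rewrite (bigID (fun s : cover => e.2 \in s.2) (fun s => e.1 \notin s.1))/=.
rewrite (bigID (fun s : cover => e.1 \in s.1) (fun s => e.2 \in s.2))/=.
under [X in _ + (X + _)]eq_bigl do rewrite andbC.
under [X in _ + (_ + X)]eq_bigl do rewrite andbC.
lia.
Qed.

Definition supp u : {set gen} := [set g | 0 < u g].

(** The vanishing of a potential or of a slack, expressed by the support alone, so that
    admissibility is constant on the relative interior of each cone. *)
Definition free_row U i := forall s, inl s \in U -> i \notin s.1.
Definition free_col U j := forall s, inl s \in U -> j \notin s.2.
Definition tight U (e : edge) := inr e \notin U /\
  forall s, inl s \in U -> ~~ ((e.1 \in s.1) && (e.2 \in s.2)).

(* The last field says that the dual solution is the least one: no set of
   potentials can be lowered without losing feasibility or value. *)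
Record admissible U : Prop := Admissible {
  adm_chain : forall s s', inl s \in U -> inl s' \in U ->
    (s'.1 \subset s.1) && (s.2 \subset s'.2) ||
    (s.1 \subset s'.1) && (s'.2 \subset s.2);
  adm_matching : exists M, [/\ is_k_matching k M,
    forall e, e \in M -> tight U e,
    forall i, i \notin rows M -> free_row U i &
    forall j, j \notin cols M -> free_col U j];
  adm_least : forall (A : {set 'I_m}) (B : {set 'I_n}) (b : bool),
    #|B| <= #|A| + b * (n - k) ->
    (forall i, i \in A -> ~ free_row U i) ->
    (forall i j, i \in A -> j \notin B -> ~ tight U (i, j)) ->
    (b -> forall j, j \notin B -> ~ free_col U j) ->
    [/\ A = set0, B = set0 & ~~ b] }.

Lemma sum_supp_eq0 u (P : pred cover) :
  (forall s, inl s \in supp u -> ~~ P s) <-> \sum_(s | P s) u (inl s) = 0.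
Proof.
split=> [H|/eqP]; last first.
  rewrite sum_nat_eq0 => /forallP H s; rewrite inE; apply: contraTN => Ps.
  by have /implyP/(_ Ps)/eqP -> := H s.
apply: big1 => s Ps; apply/eqP; rewrite -leqn0 leqNgt.
by apply/negP => us; have := H s; rewrite inE us Ps => /(_ isT).
Qed.

Lemma free_rowE u i : free_row (supp u) i <-> row_potential u i = 0.
Proof. exact: sum_supp_eq0. Qed.

Lemma free_colE u j : free_col (supp u) j <-> col_potential u j = 0.
Proof. exact: sum_supp_eq0. Qed.

Lemma tightE u e : tight (supp u) e <-> slack u e = 0.
Proof.
rewrite /slack; split=> [[eu /sum_supp_eq0 ->]|H].
  by move: eu; rewrite inE lt0n negbK => /eqP.
have [H1 H2] : \sum_(s : cover | (e.1 \in s.1) && (e.2 \in s.2)) u (inl s) = 0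
    /\ u (inr e) = 0 by move: H; lia.
by split; [rewrite inE H2|apply/sum_supp_eq0].
Qed.

(** Threshold sets at height [h], the column dual being [l - v j]. As [h] grows the rows shrink and
    the columns grow, so the layers form a chain. *)
Definition layer x v l (h : nat) : cover :=
  ([set i | h < x i], [set j | l <= h + v j]).

Lemma sum_layer (L : nat -> cover) l (P : pred cover) :
  \sum_(s | P s) \sum_(h < l) (L h == s) = \sum_(h < l) P (L h).
Proof.
rewrite exchange_big; apply: eq_bigr => h _.
rewrite big_mkcond (bigD1 (L h))//= eqxx big1 ?addn0; first by case: (P _).
by move=> s sL; rewrite eq_sym (negPf sL); case: (P s).
Qed.

Lemma sum_ord_itv l a b : b <= l -> \sum_(h < l) ((a <= h) && (h < b)) = b - a.
Proof.
elim: l b => [|l IH] b bl; first by rewrite big_ord0; lia.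
rewrite big_ord_recr /=; have [bl'|lb] := leqP b l.
  by rewrite IH//; lia.
have -> : b = l.+1 by lia.
rewrite (eq_bigr (fun h : 'I_l => nat_of_bool ((a <= h) && (h < l)))).
  by rewrite IH//; lia.
by move=> h _; have := ltn_ord h; lia.
Qed.

(* The cover [s] is the layer at height [h] exactly for [h] in an interval of length
   [u (inl s)] starting at the total weight of the covers preceding [s]. *)
Lemma chain_layer u : (forall s s', inl s \in supp u -> inl s' \in supp u ->
    (s'.1 \subset s.1) && (s.2 \subset s'.2) ||
    (s.1 \subset s'.1) && (s'.2 \subset s.2)) ->
  forall s, u (inl s) =
    \sum_(h < level u) (layer (row_potential u) (col_potential u) (level u) h == s).
Proof.
move=> chain; pose L := layer (row_potential u) (col_potential u) (level u).
(* Both sides sum to [level u] over all covers, so termwise inequality forces equality. *)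
suff le s : u (inl s) <= \sum_(h < level u) (L h == s).
  have /leqif_sum : forall s, predT s ->
      u (inl s) <= \sum_(h < level u) (L h == s)
      ?= iff (u (inl s) == \sum_(h < level u) (L h == s)).
    by move=> s _; split=> //; exact: le.
  case=> _; rewrite sum_layer sum1_card card_ord eqxx => /esym/forallP H s.
  exact/eqP/(H s).
have [us|] := posnP (u (inl s)); first by rewrite us.
move=> us; have sU : inl s \in supp u by rewrite inE.
pose before s' := [&& s' != s, s.1 \subset s'.1 & s'.2 \subset s.2].
pose a := \sum_(s' | before s') u (inl s').
have le_sum (P Q : pred cover) : (forall t, P t -> Q t) ->
    \sum_(t | P t) u (inl t) <= \sum_(t | Q t) u (inl t).
  move=> PQ; rewrite big_mkcond [X in _ <= X]big_mkcond; apply: leq_sum => t _.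
  by case: ifP => // /PQ ->.
have sum_s (P : pred cover) : P s ->
    \sum_(t | P t) u (inl t) = u (inl s) + \sum_(t | P t && (t != s)) u (inl t).
  by move=> Ps; rewrite (bigD1 s).
have le_level : a + u (inl s) <= level u.
  rewrite /level sum_s// addnC leq_add2l; apply: le_sum => t.
  by rewrite /before => /and3P[->].
have row_in i : i \in s.1 -> a + u (inl s) <= row_potential u i.
  move=> i_s; rewrite /row_potential sum_s// addnC leq_add2l; apply: le_sum => t.
  by move=> /and3P[ts /subsetP st _]; rewrite ts st.
have row_out i : i \notin s.1 -> row_potential u i <= a.
  move=> i_s; rewrite /row_potential /a big_mkcond [X in _ <= X]big_mkcond.
  apply: leq_sum => t _; case: ifPn => // it; case: ifPn => // nb.
  have [->//|ut] := posnP (u (inl t)); have tU : inl t \in supp u by rewrite inE.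
  have ts : t != s by apply: contraNN i_s => /eqP <-.
  have := chain s t sU tU; move: nb; rewrite /before ts /= => /negPf ->.
  by rewrite orbF => /andP[/subsetP/(_ i it)]; rewrite (negPf i_s).
have col_out j : j \notin s.2 -> a + u (inl s) + col_potential u j <= level u.
  move=> j_s; rewrite /level /col_potential [X in _ <= X](bigID (fun t : cover => j \in t.2))/=.
  rewrite addnC leq_add2l sum_s// addnC leq_add2l; apply: le_sum => t.
  move=> /and3P[-> _ /subsetP ts]; rewrite andbT; apply: contraNN j_s; exact: ts.
have col_in j : j \in s.2 -> level u <= a + col_potential u j.
  move=> j_s; rewrite /level /col_potential (bigID (fun t : cover => j \in t.2))/=.
  rewrite addnC leq_add2r /a big_mkcond [X in _ <= X]big_mkcond.
  apply: leq_sum => t _; case: ifPn => // jt; case: ifPn => // nb.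
  have [->//|ut] := posnP (u (inl t)); have tU : inl t \in supp u by rewrite inE.
  have ts : t != s by apply: contraNN jt => /eqP ->.
  have := chain s t sU tU; move: nb; rewrite /before ts /= => /negPf ->.
  by rewrite orbF => /andP[_ /subsetP/(_ j j_s)]; rewrite (negPf jt).
apply: leq_trans (_ : \sum_(h < level u) ((a <= h) && (h < a + u (inl s))) <= _).
  by rewrite sum_ord_itv// addKn.
apply: leq_sum => h _; case: andP => // -[ah ha]; rewrite lt0b.
rewrite /L /layer [eqbRHS]surjective_pairing; apply/eqP; congr (_, _).
  apply/setP => i; rewrite inE; apply/idP/idP => [|/row_in]; last lia.
  by apply: contraTT => /row_out; lia.
apply/setP => j; rewrite inE; apply/idP/idP => [|/col_in]; last lia.
by apply: contraTT => /col_out; lia.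
Qed.


(** * Uniqueness of the admissible combination *)

Lemma cost_of_eq_covers u u' :
    (forall s, u (inl s) = u' (inl s)) -> cost_of u =1 cost_of u' -> u = u'.
Proof.
move=> uu' cc'; apply/ffunP => -[s|e]; first exact: uu'.
have := cc' e; rewrite /cost_of.
rewrite (eq_bigr (fun s => u' (inl s)) (fun s _ => uu' s)).
exact: addnI.
Qed.

(* The potentials of [u] that exceed those of [u'] could all be lowered. *)
Lemma admissible_le u u' : k <= n ->
    admissible (supp u) -> admissible (supp u') -> cost_of u =1 cost_of u' ->
  [/\ forall i, row_potential u i <= row_potential u' i,
      forall j, level u + col_potential u' j <= level u' + col_potential u j &
      level u <= level u'].
Proof.
move=> kn [_ [M [Mk tM rM cM]] least] [_ [M' [M'k tM' rM' cM']] _] cc'.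
have gap (w : {ffun gen -> nat}) (N : {set edge}) (Nk : is_k_matching k N) :=
  matching_dual_gap Nk (fun e _ => cost_of_slack w e).
have gap0 (w : {ffun gen -> nat}) (N : {set edge}) :
    (forall e, e \in N -> tight (supp w) e) ->
    (forall i, i \notin rows N -> free_row (supp w) i) ->
    (forall j, j \notin cols N -> free_col (supp w) j) ->
    \sum_(e in N) slack w e + \sum_(i | i \notin rows N) row_potential w i
      + \sum_(j | j \notin cols N) col_potential w j = 0.
  move=> tN rN cN; rewrite !big1// => [e /cN|e /rN|e /tN].
  - by move/free_colE.
  - by move/free_rowE.
  - by move/tightE.
have ccM (N : {set edge}) : \sum_(e in N) cost_of u e = \sum_(e in N) cost_of u' e.
  by apply: eq_bigr => e _; exact: cc'.
have g1 := gap u M Mk; have g2 := gap u M' M'k.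
have g3 := gap u' M' M'k; have g4 := gap u' M Mk.
rewrite (gap0 u M)// in g1; rewrite (gap0 u' M')// in g3.
rewrite ccM in g1; rewrite ccM in g2.
(* [M] and [M'] have no gap for their own duals, so both are cheapest for the common cost; hence [M]
   has no gap for the dual of [u'] either. *)
have z : \sum_(e in M) slack u' e + \sum_(i | i \notin rows M) row_potential u' i
      + \sum_(j | j \notin cols M) col_potential u' j = 0 by lia.
have sM' e : e \in M -> slack u' e = 0.
  move=> eM; have : \sum_(e in M) slack u' e = 0 by lia.
  by rewrite (bigD1 e)//=; lia.
have xM' i : i \notin rows M -> row_potential u' i = 0.
  move=> iM; have : \sum_(i | i \notin rows M) row_potential u' i = 0 by lia.
  by rewrite (bigD1 i)//=; lia.
have vM' j : j \notin cols M -> col_potential u' j = 0.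
  move=> jM; have : \sum_(j | j \notin cols M) col_potential u' j = 0 by lia.
  by rewrite (bigD1 j)//=; lia.
clear g1 g2 g3 g4 z gap gap0.
(* Moving from [u] towards [u'] would lower the row potentials in [A], the column duals (level minus
   column potential) in [B], and the level if [b]. *)
pose A := [set i | row_potential u' i < row_potential u i].
pose B := [set j | level u' + col_potential u j < level u + col_potential u' j].
pose b := level u' < level u.
have AB e : e \in M -> (e.2 \in B) -> (e.1 \in A).
  case: e => i j eM; rewrite !inE /=.
  have := cost_of_slack u (i, j); have := cost_of_slack u' (i, j).
  have := cc' (i, j); have /tightE -> := tM _ eM; rewrite (sM' _ eM) /=; lia.
have [cardM M1 M2] := k_matchingP _ _ Mk.
have [||||A0 B0 b0] := least A B b.
(* Matched columns of [B] have their partners in [A]; the [n - k] unmatched columns lie in [B] only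
   if [b]. *)
- rewrite -(cardsID (cols M) B) leq_add//.
    have /subset_leq_card : B :&: cols M \subset snd @: [set e in M | e.1 \in A].
      apply/subsetP => j; rewrite inE => /andP[jB /imsetP[e eM je]].
      by apply/imsetP; exists e => //; rewrite inE eM AB// -je.
    move=> /leq_trans; apply; rewrite (leq_trans (leq_imset_card _ _))//.
    rewrite -(card_in_imset (f := fst)); last first.
      by move=> e f; rewrite !inE => /andP[eM _] /andP[fM _]; exact: M1.
    by apply: subset_leq_card; apply/subsetP => i /imsetP[e] /[!inE] /andP[_ ?] ->.
  have cardC : #|~: cols M| = n - k.
    by rewrite cardsCs setCK card_ord card_in_imset ?cardM.
  have [bT|bF] := boolP b.
    rewrite mul1n -cardC; apply: subset_leq_card.
    by apply/subsetP => j; rewrite !inE => /andP[].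
  rewrite mul0n leqn0 cards_eq0 -subset0; apply/subsetP => j; rewrite !inE.
  move=> /andP[jM]; rewrite vM'//; have /free_colE -> := cM j jM.
  by rewrite !addn0 => bT; case/negP: bF.
- by move=> i /[!inE] ui /free_rowE; lia.
- move=> i j /[!inE] ui uj /tightE.
  have := cost_of_slack u (i, j); have := cost_of_slack u' (i, j).
  by have := cc' (i, j); rewrite /=; lia.
- by rewrite /b => bT j /[!inE] jB /free_colE; lia.
split=> [i|j|].
- rewrite leqNgt; apply/negP => h; have : i \in A by rewrite inE.
  by rewrite A0 inE.
- rewrite leqNgt; apply/negP => h; have : j \in B by rewrite inE.
  by rewrite B0 inE.
- by rewrite leqNgt.
Qed.

(** Each of the two duals is below the other, so they coincide. The layers then recover the cover
    weights from the dual, and the cost recovers the edge weights. *)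
Lemma cost_of_inj u u' : k <= n ->
    admissible (supp u) -> admissible (supp u') -> cost_of u =1 cost_of u' ->
  u = u'.
Proof.
move=> kn au au' cc'.
have [x1 v1 l1] := admissible_le kn au au' cc'.
have [x2 v2 l2] := admissible_le kn au' au (fsym cc').
have l12 : level u = level u' by lia.
have x12 : row_potential u =1 row_potential u'.
  by move=> i; have := x1 i; have := x2 i; lia.
have v12 : col_potential u =1 col_potential u'.
  by move=> j; have := v1 j; have := v2 j; lia.
apply: cost_of_eq_covers cc' => s.
rewrite (chain_layer (adm_chain au)) (chain_layer (adm_chain au')) l12.
apply: eq_bigr => h _; congr (nat_of_bool (_ == _)).
by congr (_, _); apply/setP => ?; rewrite !inE ?x12 ?v12.
Qed.

(** * Existence of a least optimal dual solution *)

Definition optimal_dual M c x v l :=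
  [/\ forall e, l <= c e + x e.1 + v e.2,
      forall e, e \in M -> l = c e + x e.1 + v e.2,
      forall i, i \notin rows M -> x i = 0 &
      forall j, j \notin cols M -> v j = 0].

(** A move lowers by one the row potentials in [A], the column duals [l - v j] in [B] and, if [b],
    the level. It changes the dual value by [#|A| + b * (n - k) - #|B|], so the first condition says
    that no value is lost. The others keep the potentials nonnegative and the dual feasible. Only
    the trivial move may satisfy them all. *)
Definition least_dual c x v l :=
  forall (A : {set 'I_m}) (B : {set 'I_n}) (b : bool),
    #|B| <= #|A| + b * (n - k) ->
    (forall i, i \in A -> x i <> 0) ->
    (forall i j, i \in A -> j \notin B -> l <> c (i, j) + x i + v j) ->
    (b -> forall j, j \notin B -> v j <> 0) ->
    [/\ A = set0, B = set0 & ~~ b].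

Lemma optimal_dual_exists c : 0 < k <= minn m n ->
  exists M x v l, is_k_matching k M /\ optimal_dual M c x v l.
Proof.
move=> hk; have [M [x [y [l [Mk [x0 yl feas] tM rM cM]]]]] := k_matching_duality c hk.
have [e0 e0M] : exists e, e \in M.
  by apply/card_gt0P; have [-> _ _] := k_matchingP _ _ Mk; case/andP: hk.
have l0 : (0 <= l)%R.
  by have := tM e0 e0M; have := yl e0.2; have := x0 e0.1; lia.
exists M, (fun i => `|x i|), (fun j => `|(l - y j)%R|), `|l|; split=> //; split.
- move=> e; have := feas e.1 e.2; have := yl e.2; have := x0 e.1.
  by rewrite -surjective_pairing; lia.
- by move=> e eM; have := tM e eM; have := yl e.2; have := x0 e.1; lia.
- by move=> i /rM ->.
- by move=> j /cM ->; rewrite subrr.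
Qed.

Lemma optimal_dual_le M c x v l : is_k_matching k M -> 0 < k ->
  optimal_dual M c x v l -> (forall i, x i <= l) /\ (forall j, v j <= l).
Proof.
move=> Mk k0 [feas tM rM cM]; split=> [i|j].
  have [/imsetP[e eM ->]|/rM ->//] := boolP (i \in rows M).
  by have := tM e eM; lia.
have [/imsetP[e eM ->]|/cM ->//] := boolP (j \in cols M).
by have := tM e eM; lia.
Qed.

(** Descent: a nontrivial move leads to another optimal dual and lowers the sum of the row
    potentials, the column duals and the level by [#|A| + #|B| + b]. *)
Lemma least_optimal_dual_exists c : 0 < k <= minn m n ->
  exists M x v l, [/\ is_k_matching k M, optimal_dual M c x v l & least_dual c x v l].
Proof.
move=> hk; have [M [x [v [l [Mk opt]]]]] := optimal_dual_exists c hk.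
exists M; have k0 : 0 < k by case/andP: hk.
have kn : k <= n by move: hk; lia.
have [N] := ubnP (\sum_i x i + \sum_j (l - v j) + l).
elim: N => // N IH in x v l opt * => ltN.
have [least|/existsNP[A /existsNP[B /existsNP[b]]]] := pselect (least_dual c x v l).
  by exists x, v, l.
move=> /not_implyP[cAB /not_implyP[hA /not_implyP[hAB /not_implyP[hb ABb]]]].
have [xl vl] := optimal_dual_le Mk k0 opt.
have [feas tM rM cM] := opt.
(* At level 0 all potentials vanish, so [B] contains every column and, as [k > 0], [A] is nonempty;
   but the row potentials in [A] are positive. *)
have l0 : b -> 0 < l.
  move=> bT; rewrite lt0n; apply/eqP => l0.
  have BT : B = setT.
    apply/setP => j; rewrite inE; apply: contraT => jB.
    by have := hb bT j jB; have := vl j; lia.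
  move: cAB; rewrite BT cardsT card_ord bT mul1n => cAB.
  have /card_gt0P[i iA] : 0 < #|A| by lia.
  by have := hA i iA; have := xl i; lia.
have vb j : b -> j \notin B -> 0 < v j by move=> bT jB; have := hb bT j jB; lia.
pose x' i := x i - (i \in A); pose v' j := v j + (j \in B) - b; pose l' := l - b.
have feas' e : l' <= c e + x' e.1 + v' e.2.
  have := feas e; rewrite /x' /v' /l'.
  have := hA e.1; have := hAB e.1 e.2; have := @vb e.2; rewrite -surjective_pairing.
  move: l0; case: b {cAB hb ABb vb l' v'} => //=; case: (_ \in A); case: (_ \in B) => //=; lia.
pose d e := c e + x' e.1 + v' e.2 - l'.
have gap := matching_dual_gap (d := d) (x := x') (v := v') (l := l') Mk
  (fun e _ => esym (subnK (feas' e))).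
have gap0 := matching_dual_gap (d := fun=> 0) (x := x) (v := v) (l := l) Mk
  (fun e eM => esym (tM e eM)).
have sx : \sum_i x i = \sum_i x' i + #|A|.
  rewrite -sum1_card [X in _ + X]big_mkcond -big_split/=; apply: eq_bigr => i _.
  by rewrite /x'; have := hA i; case: (i \in A) => //=; lia.
have sv : \sum_j v' j + b * n = \sum_j v j + #|B|.
  rewrite -sum1_card [X in _ = _ + X]big_mkcond -big_split/=.
  rewrite -[X in b * X]card_ord mulnC -sum_nat_const -big_split/=; apply: eq_bigr => j _.
  rewrite /v'; have := @vb j; case: (j \in B); case: (b) => //=; lia.
have kl : k * l = k * l' + k * b.
  by rewrite -mulnDr; congr muln; rewrite /l'; move: l0; case: (b) => //=; lia.
have bkn : b * n = b * (n - k) + k * b by rewrite [k * b]mulnC -mulnDr subnK.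
rewrite [X in _ = _ + X](_ : _ = 0) in gap0; last by rewrite !big1.
(* The dual value was already the cost of [M] and has not dropped, so [M] still has no gap and
   complementary slackness persists. *)
have z : \sum_(e in M) d e + \sum_(i | i \notin rows M) x' i
    + \sum_(j | j \notin cols M) v' j = 0 by lia.
have opt' : optimal_dual M c x' v' l'.
  split=> // [e eM|i iM|j jM].
  - have : \sum_(e in M) d e = 0 by lia.
    by rewrite (bigD1 e)//= /d; have := feas' e; lia.
  - have : \sum_(i | i \notin rows M) x' i = 0 by lia.
    by rewrite (bigD1 i)//=; lia.
  - have : \sum_(j | j \notin cols M) v' j = 0 by lia.
    by rewrite (bigD1 j)//=; lia.
have [xl' vl'] := optimal_dual_le Mk k0 opt'.
apply: (IH x' v' l') => //; move: ltN; rewrite ltnS => /(leq_trans _); apply.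
have sl : \sum_j (l - v j) = \sum_j (l' - v' j) + #|B|.
  rewrite -sum1_card [X in _ = _ + X]big_mkcond -big_split/=; apply: eq_bigr => j _.
  have := @vb j; have := vl' j; rewrite /v' /l'.
  by move: l0; case: (j \in B); case: (b) => //=; lia.
have : ~ (#|A| = 0 /\ #|B| = 0 /\ ~~ b).
  by move=> [/eqP + [/eqP + nb]]; rewrite !cards_eq0 => /eqP A0 /eqP B0; apply: ABb.
have : l = l' + b by rewrite /l'; move: l0; case: (b) => //=; lia.
move: sx sl; clearbody x' v' l'; clear.
move: #|A| #|B| (\sum_i x i) (\sum_i x' i) (\sum_j (l - v j)) (\sum_j (l' - v' j)).
case: b => /=; lia.
Qed.

(** The layers of a least optimal dual give the cover weights, and each edge generator receives what
    remains of the cost of its edge. *)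
Lemma cost_of_surj c : 0 < k <= minn m n ->
  exists2 u, admissible (supp u) & cost_of u =1 c.
Proof.
move=> hk; have [M [x [v [l [Mk opt least]]]]] := least_optimal_dual_exists c hk.
have [xl vl] := optimal_dual_le Mk (proj1 (andP hk)) opt.
have [feas tM rM cM] := opt.
pose L := layer x v l.
pose w (s : cover) := \sum_(h < l) (L h == s).
pose u : {ffun gen -> nat} := [ffun g => match g with inl s => w s
  | inr e => c e - \sum_(s : cover | (e.1 \notin s.1) && (e.2 \notin s.2)) w s end].
have uw (P : pred cover) : \sum_(s | P s) u (inl s) = \sum_(h < l) P (L h).
  by rewrite -(sum_layer L l P); apply: eq_bigr => s _; rewrite ffunE.
have xu i : row_potential u i = x i.
  rewrite /row_potential uw -[RHS]subn0 -(sum_ord_itv 0 (xl i)).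
  by apply: eq_bigr => h _; rewrite inE.
have lu : level u = l by rewrite /level uw sum1_card card_ord.
have vu j : col_potential u j = v j.
  rewrite /col_potential uw -[RHS](subKn (vl j)) -(sum_ord_itv (l - v j) (leqnn l)).
  by apply: eq_bigr => h _; rewrite inE ltn_ord andbT; congr nat_of_bool; lia.
have cu : cost_of u =1 c.
  move=> [i j]; rewrite /cost_of uw ffunE.
  rewrite [X in c _ - X](sum_layer L l (fun s => (i \notin s.1) && (j \notin s.2))).
  (* Layer [h] misses [(i, j)] when [x i <= h < l - v j]; feasibility bounds the number of such
     layers by [c (i, j)]. *)
  rewrite /= subnKC// (@leq_trans (l - v j - x i))//; last first.
    by have := feas (i, j); rewrite /=; lia.
  rewrite -(@sum_ord_itv l); last lia.
  by apply: leq_sum => h _; rewrite !inE; case: andP => //= -[h1 h2]; rewrite lt0b; lia.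
have dE e : slack u e = c e + x e.1 + v e.2 - l.
  by case: e => i j; have := cost_of_slack u (i, j); rewrite cu xu vu lu /=; lia.
exists u => //; split=> [s s'||A B b cAB hA hAB hb].
- have LU t : inl t \in supp u -> exists h, t = L h.
    rewrite inE ffunE lt0n sum_nat_eq0 => /forallPn[h].
    by rewrite /= eqb0 negbK => /eqP; exists h.
  move=> /LU[h ->] /LU[h' ->]; case/orP: (leq_total h h') => hh'; apply/orP.
    by left; apply/andP; split; apply/subsetP => ?; rewrite !inE; lia.
  by right; apply/andP; split; apply/subsetP => ?; rewrite !inE; lia.
- exists M; split=> // [e eM|i iM|j jM].
  + by apply/tightE; rewrite dE -(tM e eM) subnn.
  + by apply/free_rowE; rewrite xu rM.
  + by apply/free_colE; rewrite vu cM.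
- apply: least => // [i iA|i j iA jB|bT j jB].
  + by move=> xi; apply: (hA i iA); apply/free_rowE; rewrite xu.
  + move=> lE; apply: (hAB i j iA jB); apply/tightE; rewrite dE.
    by apply/eqP; rewrite subn_eq0 [X in _ <= X]lE.
  + by move=> vj; apply: (hb bT j jB); apply/free_colE; rewrite vu.
Qed.

(** Unmatched rows and columns are free, so [s] contains only matched ones, and by tightness no edge
    of [M] has both ends in [s]; this gives the last bound. The strict bounds come from
    leastness. *)
Lemma admissible_card U s : k <= n -> admissible U -> inl s \in U ->
  [/\ #|s.1| < m, #|s.2| < n & #|s.1| + #|s.2| <= k].
Proof.
move=> kn [_ [M [Mk tM rM cM]] least] sU; have [cardM M1 M2] := k_matchingP _ _ Mk.
have s1M : s.1 \subset rows M.
  by apply/subsetP => i; apply: contraTT => /rM/(_ s sU).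
have s2M : s.2 \subset cols M.
  by apply/subsetP => j; apply: contraTT => /cM/(_ s sU).
split.
- rewrite ltn_neqAle -[X in _ <= X]card_ord max_card andbT; apply/eqP => s1.
  have s1T : s.1 = setT by apply/eqP; rewrite eqEcard subsetT cardsT card_ord s1 /=.
  (* If [s] contained all rows, the row potentials, the column duals and the level could all drop
     together. *)
  have [||||_ _ //] := least setT setT true.
  - rewrite !cardsT !card_ord mul1n.
    have := max_card (mem (rows M)); rewrite card_in_imset// cardM card_ord; lia.
  - by move=> i _ /(_ s sU); rewrite s1T inE.
  - by move=> i j _; rewrite inE.
  - by move=> _ j; rewrite inE.
- rewrite ltn_neqAle -[X in _ <= X]card_ord max_card andbT; apply/eqP => s2.
  have s2T : s.2 = setT by apply/eqP; rewrite eqEcard subsetT cardsT card_ord s2 /=.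
  (* If [s] contained all columns, the level could drop alone. *)
  have [||||_ _ //] := least set0 set0 true.
  - by rewrite cards0.
  - by move=> i; rewrite inE.
  - by move=> i j; rewrite inE.
  - by move=> _ j _ /(_ s sU); rewrite s2T inE.
- rewrite -cardM.
  have -> : #|s.1| = #|[set e in M | e.1 \in s.1]|.
    rewrite -(card_in_imset (f := fst)); last first.
      by move=> e f; rewrite !inE => /andP[eM _] /andP[fM _]; exact: M1.
    apply: eq_card => i; apply/idP/imsetP => [is1|[e /[!inE] /andP[_ ?] ->//]].
    have /imsetP[e eM ie] := subsetP s1M i is1.
    by exists e => //; rewrite inE eM -ie.
  have -> : #|s.2| = #|[set e in M | e.2 \in s.2]|.
    rewrite -(card_in_imset (f := snd)); last first.
      by move=> e f; rewrite !inE => /andP[eM _] /andP[fM _]; exact: M2.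
    apply: eq_card => i; apply/idP/imsetP => [is1|[e /[!inE] /andP[_ ?] ->//]].
    have /imsetP[e eM ie] := subsetP s2M i is1.
    by exists e => //; rewrite inE eM -ie.
  rewrite -cardsUI [X in _ + X](_ : _ = 0) ?addn0.
    by apply: subset_leq_card; apply/subsetP => e; rewrite !inE -andb_orr => /andP[].
  apply/eqP; rewrite cards_eq0; apply/eqP/setP => e; rewrite !inE.
  apply/negP => /andP[/andP[eM e1] /andP[_ e2]].
  by have [_ /(_ s sU)] := tM e eM; rewrite e1 e2.
Qed.

(** * Minimum cost and total cost of a combination *)

Lemma card_matching_miss M (s : cover) : is_k_matching k M ->
  k - #|s.1| - #|s.2| <= #|[set e in M | (e.1 \notin s.1) && (e.2 \notin s.2)]|.
Proof.
move=> Mk; have [cardM M1 M2] := k_matchingP _ _ Mk.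
have h1 : #|[set e in M | e.1 \in s.1]| <= #|s.1|.
  rewrite -(card_in_imset (f := fst)); last first.
    by move=> e f; rewrite !inE => /andP[eM _] /andP[fM _]; exact: M1.
  by apply: subset_leq_card; apply/subsetP => i /imsetP[e] /[!inE] /andP[_ ?] ->.
have h2 : #|[set e in M | e.2 \in s.2]| <= #|s.2|.
  rewrite -(card_in_imset (f := snd)); last first.
    by move=> e f; rewrite !inE => /andP[eM _] /andP[fM _]; exact: M2.
  by apply: subset_leq_card; apply/subsetP => i /imsetP[e] /[!inE] /andP[_ ?] ->.
have : M \subset [set e in M | e.1 \in s.1] :|: [set e in M | e.2 \in s.2]
    :|: [set e in M | (e.1 \notin s.1) && (e.2 \notin s.2)].
  by apply/subsetP => e eM; rewrite !inE eM /=; case: (_ \in _); case: (_ \in _).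
move=> /subset_leq_card; rewrite cardM => h.
have := (leq_card_setU ([set e in M | e.1 \in s.1] :|: [set e in M | e.2 \in s.2])
  [set e in M | (e.1 \notin s.1) && (e.2 \notin s.2)]).1.
have := (leq_card_setU [set e in M | e.1 \in s.1] [set e in M | e.2 \in s.2]).1.
lia.
Qed.

Lemma sum_cost_of (Z : {set edge}) u : \sum_(e in Z) cost_of u e =
  \sum_(s : cover) u (inl s) * #|[set e in Z | (e.1 \notin s.1) && (e.2 \notin s.2)]|
  + \sum_(e in Z) u (inr e).
Proof.
rewrite big_split/=; congr (_ + _); rewrite (exchange_big_dep xpredT)//=.
apply: eq_bigr => s _; rewrite -sum1_card big_distrr/=.
by apply: eq_big => [e|e _]; rewrite ?inE ?muln1.
Qed.

(* The truncated subtraction is exact on admissible supports. *)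
Definition dual_value u := \sum_(s : cover) u (inl s) * (k - #|s.1| - #|s.2|).

Lemma dual_value_le u M : is_k_matching k M ->
  dual_value u <= \sum_(e in M) cost_of u e.
Proof.
move=> Mk; rewrite sum_cost_of (leq_trans _ (leq_addr _ _))//.
by apply: leq_sum => s _; rewrite leq_mul// card_matching_miss.
Qed.

(** The matching of an admissible support uses each row and column of a supported cover, no two by
    the same edge, so it misses the cover in exactly [k - #|s.1| - #|s.2|] edges. It contains no
    edge whose generator is in the support. *)
Lemma dual_value_attained u : k <= n -> admissible (supp u) ->
  exists2 M, is_k_matching k M & \sum_(e in M) cost_of u e = dual_value u.
Proof.
move=> kn au; have [M [Mk tM rM cM]] := adm_matching au; exists M => //.
have [cardM M1 M2] := k_matchingP _ _ Mk.
rewrite sum_cost_of [X in _ + X]big1 ?addn0 => [|e /tM[]]; last first.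
  by rewrite inE lt0n negbK => /eqP.
apply: eq_bigr => s _; have [->|us] := posnP (u (inl s)); first by rewrite !mul0n.
congr muln; apply/eqP; rewrite eqn_leq card_matching_miss// andbT.
have sU : inl s \in supp u by rewrite inE.
have s1M : s.1 \subset [set e.1 | e in [set e in M | e.1 \in s.1]].
  apply/subsetP => i is1; have /imsetP[e eM ie] : i \in rows M.
    by apply: contraTT is1 => /rM/(_ s sU).
  by apply/imsetP; exists e => //; rewrite inE eM -ie.
have s2M : s.2 \subset [set e.2 | e in [set e in M | e.2 \in s.2]].
  apply/subsetP => i is1; have /imsetP[e eM ie] : i \in cols M.
    by apply: contraTT is1 => /cM/(_ s sU).
  by apply/imsetP; exists e => //; rewrite inE eM -ie.
have h1 : #|s.1| <= #|[set e in M | e.1 \in s.1]| :=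
  leq_trans (subset_leq_card s1M) (leq_imset_card _ _).
have h2 : #|s.2| <= #|[set e in M | e.2 \in s.2]| :=
  leq_trans (subset_leq_card s2M) (leq_imset_card _ _).
have D12 : [set e in M | e.1 \in s.1] :&: [set e in M | e.2 \in s.2] = set0.
  apply/setP => e; rewrite !inE; apply/negP => /andP[/andP[eM e1] /andP[_ e2]].
  by have [_ /(_ s sU)] := tM e eM; rewrite e1 e2.
have D3 : [set e in M | e.1 \in s.1] :|: [set e in M | e.2 \in s.2] =
    M :\: [set e in M | (e.1 \notin s.1) && (e.2 \notin s.2)].
  by apply/setP => e; rewrite !inE; do 3 case: (_ \in _).
have := cardsUI [set e in M | e.1 \in s.1] [set e in M | e.2 \in s.2].
rewrite D12 cards0 addn0 D3 cardsD (setIidPr _); last first.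
  by apply/subsetP => e; rewrite inE => /andP[].
rewrite cardM; set c0 := #|[set e in M | (e.1 \notin s.1) && (e.2 \notin s.2)]|.
have : c0 <= k.
  by rewrite -cardM; apply: subset_leq_card; apply/subsetP => e; rewrite inE => /andP[].
move: h1 h2; set a1 := #|[set e in M | e.1 \in s.1]|.
set a2 := #|[set e in M | e.2 \in s.2]|; set s1 := #|s.1|; set s2 := #|s.2|.
clearbody c0 a1 a2 s1 s2; lia.
Qed.


Lemma card_edges_missed (s : cover) :
  #|[set e : edge | (e.1 \notin s.1) && (e.2 \notin s.2)]| = (m - #|s.1|) * (n - #|s.2|).
Proof.
have <- : #|~: s.1| = m - #|s.1| by rewrite cardsCs setCK card_ord.
have <- : #|~: s.2| = n - #|s.2| by rewrite cardsCs setCK card_ord.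
by rewrite -cardsX; apply: eq_card => e; rewrite !inE.
Qed.

Lemma total_cost_of u : \sum_e cost_of u e =
  \sum_(s : cover) u (inl s) * ((m - #|s.1|) * (n - #|s.2|)) + \sum_e u (inr e).
Proof.
have sumT F : \sum_(e in [set: edge]) F e = \sum_e F e by apply: eq_bigl => e; rewrite inE.
rewrite -!sumT sum_cost_of; congr (_ + _).
apply: eq_bigr => s _; rewrite -card_edges_missed; congr muln.
by apply: eq_card => e; rewrite !inE.
Qed.

Lemma cost_of_le u e : cost_of u e <= \sum_g u g.
Proof.
rewrite big_sumType /= leq_add//.
  by rewrite big_mkcond; apply: leq_sum => s _; case: ifP.
by rewrite (bigD1 e)//= leq_addr.
Qed.

(* Otherwise the points with support [U] in a large box would outnumber the costs
   they can be mapped to. *)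
Lemma admissible_dim U : k <= n -> admissible U -> #|U| <= m * n.
Proof.
move=> kn aU; rewrite leqNgt; apply/negP => DU.
(* The costs are at most [G * L], and [L] exceeds [G.+1 ^ (m * n)], so that [L ^ (m * n).+1] points
   outnumber [(G * L).+1 ^ (m * n)] costs. *)
pose G := #|{: gen}|; pose L := (G.+1 ^ (m * n)).+1.
pose H := {g : gen | g \in U}.
pose u (f : {ffun H -> 'I_L}) : {ffun gen -> nat} :=
  [ffun g => if insub g is Some h then (f h).+1 else 0].
have suppu f : supp (u f) = U.
  apply/setP => g; rewrite inE ffunE; case: insubP => [h gU _|/negPf ->//].
  by rewrite gU.
have uL f g : u f g <= L by rewrite ffunE; case: insubP => //= h _ _; exact: ltn_ord.
have costL f e : cost_of (u f) e < (G * L).+1.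
  rewrite ltnS (leq_trans (cost_of_le _ _))// -sum_nat_const.
  exact: leq_sum.
pose cc (f : {ffun H -> 'I_L}) : {ffun edge -> 'I_(G * L).+1} :=
  [ffun e => Ordinal (costL f e)].
have cc_inj : injective cc.
  move=> f f' ff'; have uu' : u f = u f'.
    apply: cost_of_inj => //; rewrite ?suppu// => e.
    by have /(congr1 val) := congr1 (fun h : {ffun _ -> _} => h e) ff'; rewrite !ffunE.
  apply/ffunP => h; have := congr1 (fun w : {ffun _ -> _} => w (val h)) uu'.
  by rewrite !ffunE valK => -[] /val_inj.
have := leq_card _ cc_inj; rewrite !card_ffun !card_ord card_sig card_prod !card_ord.
apply/negP; rewrite -ltnNge.
have -> : #|[pred x in U]| = #|U| by apply: eq_card.
apply: (@leq_trans (L ^ (m * n).+1)); last by rewrite leq_pexp2l.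
apply: (@leq_ltn_trans ((G.+1 * L) ^ (m * n))).
  by case: (m * n) => // D; rewrite leq_exp2r// mulSn -addn1 addnC leq_add2r.
by rewrite expnMn expnS ltn_pmul2r ?expn_gt0.
Qed.

(** Covers of a chain are comparable in rows and in columns, and equal cardinalities turn inclusions
    into equalities. This keeps any factor of the denominator from occurring twice in one cone. *)
Lemma admissible_card_inj U s s' : admissible U -> inl s \in U -> inl s' \in U ->
  #|s.1| = #|s'.1| -> #|s.2| = #|s'.2| -> s = s'.
Proof.
case: s s' => [A B] [A' B'] aU sU sU' /= cA cB.
have eqs (T : finType) (Z Z' : {set T}) : Z \subset Z' -> #|Z| = #|Z'| -> Z = Z'.
  by move=> ZZ' cZ; apply/eqP; rewrite eqEcard ZZ' cZ /=.
by case/orP: (adm_chain aU sU sU') => /andP[/= hA hB]; congr (_, _);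
  (exact: eqs || by symmetry; exact: eqs).
Qed.

End Triangulation.

From mathcomp Require Import all_classical all_reals all_analysis.
From mathcomp Require Import measurable_realfun.

Import Order.TTheory GRing.Theory Num.Theory.
Import numFieldNormedType.Exports.
Local Open Scope classical_set_scope.
Local Open Scope ring_scope.

(** * Sums over families of natural numbers *)

Section EsumFfun.
Variable R : realType.
Local Open Scope ereal_scope.

Lemma subset_esum (T : choiceType) (A B : set T) (a : T -> \bar R) :
  A `<=` B -> \esum_(i in A) a i <= \esum_(i in B) a i.
Proof.
move=> AB; apply: le_ereal_sup => _ [X [fX XA] <-].
by exists X => //; split => //; exact: subset_trans AB.
Qed.

Lemma esum_finType (T : finType) (a : T -> \bar R) : (forall i, 0 <= a i) ->
  \esum_(i in [set: T]) a i = \sum_i a i.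
Proof.
move=> a0; have -> : [set: T] = [set` index_enum T].
  by apply/seteqP; split=> //= i _; exact: mem_index_enum.
by rewrite esum_fset// -fsbig_seq// index_enum_uniq.
Qed.

Lemma esum_nat_cvg (a : nat -> R) (S : R) : (forall n, 0 <= a n)%R ->
  (series a @ \oo --> S)%R -> \esum_(n in [set: nat]) (a n)%:E = S%:E.
Proof.
move=> a0 aS; rewrite -nneseries_esumT => [|n]; last by rewrite lee_fin.
apply/cvg_lim => //; under eq_fun do rewrite sumEFin.
by apply/cvg_EFin; [exact: nearW|exact: aS].
Qed.

Lemma esum_geometric_pos (w : R) : (0 <= w < 1)%R ->
  \esum_(n in [set: nat]) ((0 < n)%:R * w ^+ n)%:E = (w / (1 - w))%:E.
Proof.
move=> w01; apply: esum_nat_cvg => [n|].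
  by rewrite mulr_ge0// exprn_ge0//; case/andP: w01.
have /andP[w0 w1] := w01.
have := @cvg_geometric_series R w w; rewrite ger0_norm// => /(_ w1).
set f := fun n => _; rewrite -(cvg_shiftS (series f)).
suff -> : [sequence series f n.+1]_n = series (geometric w w) by [].
apply/funext => n; rewrite /series /= big_nat_recl// /f mul0r add0r.
by apply: eq_bigr => i _; rewrite mul1r exprS.
Qed.

(** The sum over a box is the product of the partial sums; every finite set of families lies in some
    box, and the products converge. *)
Lemma esum_ffun_prod (K : finType) (f : K -> nat -> R) (S : K -> R) :
    (forall g n, (0 <= f g n)%R) ->
    (forall g, \esum_(n in [set: nat]) (f g n)%:E = (S g)%:E) ->
  \esum_(u in [set: {ffun K -> nat}]) (\prod_g f g (u g))%:E = (\prod_g S g)%:E.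
Proof.
move=> f0 fS.
have fcvg g : (series (f g) @ \oo --> S g)%R.
  have := fS g; rewrite -nneseries_esumT => [|n]; last by rewrite lee_fin.
  move=> H; have : (fun n => \sum_(0 <= i < n) (f g i)%:E) @ \oo --> (S g)%:E.
    by rewrite -H; apply: is_cvg_nneseries => n _ _; rewrite lee_fin.
  by under eq_fun do rewrite sumEFin; move/fine_cvgP => [].
pose box L (h : {ffun K -> 'I_L}) : {ffun K -> nat} := [ffun g => nat_of_ord (h g)].
have sum_box L : \esum_(u in range (box L)) (\prod_g f g (u g))%:E
    = (\prod_g series (f g) L)%:E.
  rewrite esum_image; last first.
    move=> h h' _ _ /ffunP hh'; apply/ffunP => g; apply: val_inj.
    by have := hh' g; rewrite !ffunE.
  rewrite esum_finType => [|h]; last by rewrite lee_fin prodr_ge0.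
  rewrite sumEFin; congr EFin; under [RHS]eq_bigr do rewrite /series/= big_mkord.
  rewrite bigA_distr_bigA/=; apply: eq_bigr => h _; apply: eq_bigr => g _.
  by rewrite ffunE.
have prod_cvg : (\prod_g series (f g) L @[L --> \oo] --> \prod_g S g)%R.
  by apply: cvg_big => //; exact: mul_continuous.
apply/eqP; rewrite eq_le; apply/andP; split.
  apply: ge_ereal_sup => _ [X [fX _] <-].
  have [L XL] : exists L, X `<=` range (box L).
    have [s Xs] := (finite_seqP X).1 fX.
    pose L := (\big[maxn/0%N]_(u <- s) \max_g u g).+1.
    exists L => u Xu.
    have uL g : (u g < L)%N.
      rewrite ltnS (leq_trans (leq_bigmax g))//.
      by apply: (@leq_bigmax_seq _ _ predT (fun u : {ffun K -> nat} => \max_g u g)%N) => //;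
        move: Xu; rewrite Xs.
    exists [ffun g => Ordinal (uL g)] => //.
    by apply/ffunP => g; rewrite !ffunE.
  apply: (@le_trans _ _ (\esum_(u in range (box L)) (\prod_g f g (u g))%:E)).
    by apply: ereal_sup_ubound; exists X.
  rewrite sum_box lee_fin; apply: ler_prod => g _.
  rewrite sumr_ge0//= -lee_fin -fS -nneseries_esumT => [|n]; last by rewrite lee_fin.
  by rewrite /series/= -sumEFin; apply: nneseries_lim_ge => n _; rewrite lee_fin.
have prod_cvgE : (\prod_g series (f g) L)%:E @[L --> \oo] --> (\prod_g S g)%:E.
  by apply/cvg_EFin; [exact: nearW|exact: prod_cvg].
apply: cvge_le prod_cvgE; apply: nearW => L.
by rewrite -sum_box; exact: subset_esum.
Qed.

Lemma esum_delta0 : \esum_(n in [set: nat]) ((n == 0)%:R : R)%:E = 1.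
Proof.
apply: esum_nat_cvg => //; rewrite -cvg_shiftS.
rewrite (_ : [sequence _]_n = cst 1%R); first exact: cvg_cst.
apply/funext => n; rewrite /series /= big_nat_recl//= big1 ?addr0//.
Qed.

(** Sorting the families by their support leaves, for each support, a product of geometric series
    starting at exponent 1. *)
Lemma esum_supp (K : finType) (w : K -> R) (F : pred {set K}) :
    (forall g, 0 <= w g)%R -> (forall U g, F U -> g \in U -> (w g < 1)%R) ->
  \esum_(u in [set u : {ffun K -> nat} | F [set g | (0 < u g)%N]%SET])
    (\prod_g w g ^+ u g)%:E =
  (\sum_(U | F U) \prod_(g in U) (w g / (1 - w g)))%:E.
Proof.
move=> w0 w1; rewrite esum_mkcond.
pose f (U : {set K}) g n : R :=
  if g \in U then ((0 < n)%N%:R * w g ^+ n)%R else (n == 0%N)%:R.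
have f0 U g n : (0 <= f U g n)%R.
  by rewrite /f; case: ifP => // _; rewrite mulr_ge0// exprn_ge0.
have fE (u : {ffun K -> nat}) U : (\prod_g f U g (u g) =
    if U == [set g | (0 < u g)%N]%SET then \prod_g w g ^+ u g else 0)%R.
  case: eqP => [->|/eqP].
    by apply: eq_bigr => g _; rewrite /f inE; case: posnP => [->|]; rewrite ?mul1r ?expr0.
  rewrite finset.eqEsubset negb_and => /orP[] /fintype.subsetPn[g]; rewrite !inE => gU.
    by rewrite (bigD1 g)//= /f gU => /negPf ->; rewrite !mul0r.
  rewrite (bigD1 g)//= /f => /negPf ->.
  by rewrite -leqn0 leqNgt gU mul0r.
transitivity (\esum_(u in [set: {ffun K -> nat}])
    \sum_(U | F U) (\prod_g f U g (u g))%:E).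
  apply: eq_esum => u _; rewrite sumEFin.
  under [in RHS]eq_bigr do rewrite fE.
  rewrite -big_mkcondr/=; case: ifPn => [/set_mem/= Fu|nFu].
    rewrite (big_pred1 [set g | (0 < u g)%N]%SET)// => U.
    by rewrite /= andbC; case: eqP => // ->; rewrite Fu.
  rewrite big1// => U /andP[FU /eqP UE]; case/negP: nFu; apply/mem_set.
  by rewrite /= -UE.
rewrite esum_sum => [|u U _ _]; last by rewrite lee_fin prodr_ge0.
rewrite -sumEFin; apply: eq_bigr => U FU.
rewrite (@esum_ffun_prod _ (f U) (fun g => if g \in U then w g / (1 - w g) else 1)%R)//.
  by rewrite -big_mkcond.
move=> g; rewrite /f; case: ifPn => gU; last exact: esum_delta0.
by rewrite esum_geometric_pos// w0 (w1 U).
Qed.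

Lemma esum_geometric_infty (w : R) : (1 <= w)%R ->
  \esum_(n in [set: nat]) (w ^+ n)%:E = +oo.
Proof.
move=> w1; apply/eq_infty => y.
rewrite -nneseries_esumT => [|n]; last by rewrite lee_fin exprn_ge0// (le_trans ler01).
pose L := (Num.truncn `|y|).+1.
have : \sum_(0 <= i < L) (w ^+ i)%:E <= \sum_(i <oo) (w ^+ i)%:E.
  by apply: nneseries_lim_ge => n _; rewrite lee_fin exprn_ge0// (le_trans ler01).
apply: le_trans; rewrite sumEFin lee_fin.
apply: (@le_trans _ _ L%:R); first by rewrite (le_trans (ler_norm y))// ltW// truncnS_gt.
have -> : L%:R = (\sum_(i < L) (1 : R))%R by rewrite sumr_const card_ord.
rewrite big_mkord; apply: ler_sum => i _; exact: exprn_ege1.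
Qed.

End EsumFfun.

(** One inequality holds for every positive factor; the other is the same inequality applied to
    [x^-1]. *)
Lemma esumZl (R : realType) (T : choiceType) (A : set T) (a : T -> \bar R) (x : R) :
  0 < x -> (forall i, (0 <= a i)%E) ->
  (\esum_(i in A) (x%:E * a i) = x%:E * \esum_(i in A) a i)%E.
Proof.
have le y (b : T -> \bar R) : 0 < y -> (forall i, (0 <= b i)%E) ->
    (\esum_(i in A) (y%:E * b i) <= y%:E * \esum_(i in A) b i)%E.
  move=> y0 b0; apply: ge_ereal_sup => _ [B [fB BA] <-].
  rewrite -ge0_mule_fsumr// lee_pmul2l// ?lte_fin//.
  by apply: ereal_sup_ubound; exists B.
move=> x0 a0; apply/eqP; rewrite eq_le le//=.
have x0' := lt0r_neq0 x0.
have -> : (\esum_(i in A) a i = \esum_(i in A) ((x^-1)%:E * (x%:E * a i)))%E.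
  by apply: eq_esum => i _; rewrite muleA -EFinM mulVf// mul1e.
have := le x^-1 (fun i => x%:E * a i)%E; rewrite invr_gt0 => /(_ x0) H.
have {}H := H (fun i => mule_ge0 (ltW x0 : (0 <= x%:E)%E) (a0 i)).
rewrite (le_trans (lee_wpmul2l _ H))//; first by rewrite lee_fin ltW.
by rewrite muleA -EFinM divff// mul1e.
Qed.

Lemma expRN_lt1 (R : realType) (x : R) : 0 < x -> expR (- x) < 1.
Proof. by move=> x0; rewrite -expR0 ltr_expR oppr_lt0. Qed.

Lemma expRN_itv01 (R : realType) (x : R) : 0 < x -> 0 < expR (- x) < 1.
Proof. by move=> x0; rewrite expR_gt0 expRN_lt1. Qed.

(** * Exponential costs on a grid *)

Section Cells.
Context d (T : measurableType d) (R : realType) (Pr : probability T R).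
Variables (I : finType) (X : I -> {RV Pr >-> R}).
Hypothesis hX_exp : forall i, exponentially_distributed 1 (X i).
Hypothesis hX_ind : mutually_independent X.
Variable h : R.
Hypothesis h_gt0 : 0 < h.

(** The intersection has the form in which independence is stated. The intervals are open on the
    left, so outcomes with a cost at most 0 lie in no cell; they turn out to be negligible. *)
Definition cell (c : {ffun I -> nat}) : set T :=
  \bigcap_(i in [set` [set: I]%SET])
    (X i @^-1` `](c i)%:R * h, (c i).+1%:R * h]).

Definition cell_prob (c : {ffun I -> nat}) : R :=
  \prod_i (expR (- h) ^+ c i * (1 - expR (- h))).

Lemma prob_itv_oc i (a b : R) : 0 <= a -> a < b ->
  Pr (X i @^-1` `]a, b]) = (expR (- a) - expR (- b))%:E.
Proof.
move=> a0 ab; have b0 := le_lt_trans a0 ab.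
pose mu : probability _ R := distribution Pr (X i).
have cE x : 0 <= x -> mu `[0, x]%classic = (1 - expR (- x))%:E.
  move=> x0; rewrite [LHS]hX_exp//; move: x0; rewrite le_eqVlt => /predU1P[<-|x0].
    by rewrite set_itv1 /exponential_prob integral_set1 oppr0 expR0 subrr.
  by rewrite exponential_prob_itv0c// invr1 mulN1r EFinB.
have -> : `]a, b]%classic = `[0, b]%classic `\` `[0, a]%classic :> set R.
  apply/seteqP; split=> x /=; rewrite !in_itv /=.
    move=> /andP[ax xb]; split; first by rewrite xb (ltW (le_lt_trans a0 ax)).
    by apply/negP; rewrite negb_and -!ltNge ax orbT.
  by move=> [/andP[x0 xb] /negP]; rewrite x0 /= -ltNge xb andbT.
transitivity (mu `[0%R, b]%classic - mu `[0%R, a]%classic)%E; last first.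
  by rewrite !cE// ?(ltW b0)// -EFinB; congr EFin; lra.
rewrite -[LHS]/(mu _) measureD//; last by rewrite ltey_eq fin_num_measure.
congr (_ - mu _)%E; apply/setIidPr => x /=; rewrite !in_itv /= => /andP[-> xa].
by rewrite (le_trans xa (ltW ab)).
Qed.

Lemma measurable_cell c : measurable (cell c).
Proof.
apply: fin_bigcap_measurable; first exact: finite_finset.
move=> i _; rewrite -[X in measurable X]setTI.
rewrite setTI; apply: (measurable_funPTI (X i)); exact: measurable_itv.
Qed.

Lemma cell_probE c : Pr (cell c) = (cell_prob c)%:E.
Proof.
rewrite /cell hX_ind; last by move=> i _; exact: measurable_itv.
rewrite (eq_bigr (fun i => (expR (- h) ^+ c i * (1 - expR (- h)))%:E)).
  by rewrite prodEFin /cell_prob; congr EFin; apply: eq_bigl => i; rewrite inE.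
move=> i _; rewrite prob_itv_oc.
- have e j : expR (- (j%:R * h)) = expR (- h) ^+ j by rewrite -mulrN expRM_natl.
  by rewrite !e mulrBr mulr1 exprSr.
- by rewrite mulr_ge0// ltW.
- by rewrite ltr_pM2r// ltr_nat.
Qed.

Lemma cell_prob_ge0 c : 0 <= cell_prob c.
Proof. by rewrite -lee_fin -cell_probE measure_ge0. Qed.

Lemma esum_cell_prob : (\esum_(c in [set: {ffun I -> nat}]) (cell_prob c)%:E = 1)%E.
Proof.
have /andP[q0 q1] := expRN_itv01 h_gt0; have q0' := ltW q0; have q1' := ltW q1.
rewrite (@esum_ffun_prod _ _ (fun i n => expR (- h) ^+ n * (1 - expR (- h))) (fun=> 1)) ?big1//.
  by move=> _ n; rewrite mulr_ge0 ?exprn_ge0 ?subr_ge0.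
move=> _; apply: esum_nat_cvg => [n|].
  by rewrite mulr_ge0 ?exprn_ge0 ?subr_ge0.
have := @cvg_geometric_series R (1 - expR (- h)) (expR (- h)).
rewrite ger0_norm ?(ltW q0)// => /(_ q1); rewrite divff ?subr_eq0 ?gt_eqF//.
by under eq_fun do rewrite mulrC.
Qed.

Lemma trivIset_cell : trivIset [set: {ffun I -> nat}] cell.
Proof.
move=> c c' _ _ [w [cw cw']]; apply/ffunP => i.
have := cw i; have := cw' i; rewrite /= inE => /(_ isT) + /(_ isT).
rewrite /= !in_itv /= => /andP[a1 b1] /andP[a2 b2].
have := lt_le_trans a1 b2; have := lt_le_trans a2 b1.
by rewrite !ltr_pM2r// !ltr_nat; lia.
Qed.

(** The cells are disjoint of total probability 1, so their complement is negligible. The coding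
    [pickle] arranges them in a sequence, padded with empty sets. *)
Lemma integral_cells (Z : T -> \bar R) : measurable_fun setT Z ->
  (forall w, 0 <= Z w)%E ->
  (\int[Pr]_w Z w = \esum_(c in [set: {ffun I -> nat}]) \int[Pr]_(w in cell c) Z w)%E.
Proof.
move=> mZ Z0.
pose F n := if unpickle n is Some c then
  (if pickle (c : {ffun I -> nat}) == n then cell c else set0) else set0.
have FE c : F (pickle c) = cell c by rewrite /F pickleK eqxx.
have F0 n : n \notin range (@pickle {ffun I -> nat}) -> F n = set0.
  rewrite /F; case: unpickle => [c|//]; case: eqP => // <- /negP[].
  by apply/mem_set; exists c.
have mF n : measurable (F n).
  by rewrite /F; case: unpickle => [c|//]; case: eqP => // _; exact: measurable_cell.
have tF : trivIset setT F.
  move=> i j _ _ [w []]; rewrite /F.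
  case: unpickle => [c|//]; case: eqP => // <- cw.
  case: unpickle => [c'|//]; case: eqP => // <- cw'.
  by congr pickle; apply: trivIset_cell => //; exists w.
pose D := \bigcup_n F n.
have mD : measurable D by exact: bigcup_measurable.
have sumF (Y : T -> \bar R) : measurable_fun setT Y -> (forall w, 0 <= Y w)%E ->
    (\int[Pr]_(w in D) Y w = \esum_(c in [set: {ffun I -> nat}]) \int[Pr]_(w in cell c) Y w)%E.
  move=> mY Y0; rewrite ge0_integral_bigcup//; last first.
    by apply: measurable_funS mY.
  rewrite nneseries_esumT => [|n]; last exact: integral_ge0.
  transitivity (\esum_(n in range (@pickle {ffun I -> nat})) \int[Pr]_(w in F n) Y w)%E.
    rewrite [RHS]esum_mkcond; apply: eq_esum => n _; case: ifPn => // /F0 ->.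
    by rewrite integral_set0.
  rewrite esum_image; last by move=> c c' _ _; exact: (pcan_inj pickleK).
  by apply: eq_esum => c _; rewrite FE.
have PD : Pr D = 1%E.
  have := sumF (cst 1%E); rewrite integral_cst// mul1e => ->//.
  apply: etrans esum_cell_prob; apply: eq_esum => c _.
  have mc := measurable_cell c.
  by rewrite integral_cst// mul1e; exact: cell_probE.
have PDC : Pr (~` D) = 0%E by rewrite probability_setC// PD subee.
transitivity (\int[Pr]_(w in [set: T] `\` ~` D) Z w)%E.
  by apply: ge0_negligible_integral => //; exact: measurableC.
by rewrite setTD setCK sumF.
Qed.

End Cells.

(** * Comparison of degrees by growth *)

Section PolyGrowth.
Variable R : realFieldType.
Implicit Types p q : {poly R}.

Lemma lead_coef_gt0_eventually p : 0 < lead_coef p ->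
  exists e x0, 0 < e /\ forall x, x0 <= x -> e <= p.[x].
Proof.
elim/poly_ind: p => [|p c IH]; first by rewrite lead_coef0 ltxx.
have [->|p0] := eqVneq p 0.
  rewrite mul0r add0r lead_coefC => c0; exists c, 0; split=> // x _.
  by rewrite hornerC.
rewrite lead_coefDl ?lead_coefMX; last first.
  by rewrite size_mulX// ltnS (leq_trans (size_polyC_leq1 c))// lt0n size_poly_eq0.
move=> /IH[e [x0 [e0 ex]]]; exists 1, (Num.max (Num.max x0 0) ((1 - c) / e)).
split=> // x; rewrite !ge_max => /andP[/andP[/ex px x_ge0]].
rewrite ler_pdivrMr// !hornerE => ce.
by have := ler_wpM2r x_ge0 px; rewrite [e * x]mulrC; lra.
Qed.

(** Were the degree of [p] larger, [p] and [p - c *: q] would share their leading coefficient: if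
    negative, [p] is eventually negative; if positive, [p] eventually exceeds [c *: q]. *)
Lemma leq_size_poly_growth p q (c x0 : R) : 0 < c ->
  (forall x, x0 <= x -> 0 <= p.[x] <= c * q.[x]) -> (size p <= size q)%N.
Proof.
move=> c0 pq; rewrite leqNgt; apply/negP => qp.
have p0 : p != 0 by rewrite -size_poly_gt0 (leq_ltn_trans _ qp).
have contra r : 0 < lead_coef r -> (forall x, x0 <= x -> r.[x] <= 0) -> False.
  move=> /lead_coef_gt0_eventually[e [x1 [e0 ex]]] r0.
  have := ex (Num.max x0 x1); rewrite le_max lexx orbT => /(_ isT) h1.
  have := r0 (Num.max x0 x1); rewrite le_max lexx => /(_ isT) h2.
  by move: e0; rewrite ltNge (le_trans h1 h2).
have [lp|lp|lp] := ltgtP (lead_coef p) 0.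
- apply: (contra (- p)); first by rewrite lead_coefN oppr_gt0.
  by move=> x /pq/andP[+ _]; rewrite hornerN oppr_le0.
- apply: (contra (p - c *: q)).
    by rewrite lead_coefDl// size_polyN (leq_ltn_trans (size_scale_leq _ _)).
  by move=> x /pq/andP[_ +]; rewrite !hornerE subr_le0.
- by move: lp => /eqP; rewrite lead_coef_eq0 (negPf p0).
Qed.

End PolyGrowth.

Lemma card_lt_diag (k : nat) :
  #|[pred p : 'I_k * 'I_k | (p.1 + p.2 < k)%N]| = 'C(k.+1, 2).
Proof.
rewrite -sum1_card (eq_bigl (fun p : 'I_k * 'I_k => xpredT p.1 && (p.1 + p.2 < k)%N))//.
rewrite -(pair_big_dep xpredT (fun i j : 'I_k => (i + j < k)%N) (fun _ _ => 1%N))/=.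
transitivity (\sum_(i < k) (k - i))%N.
  apply: eq_bigr => i _; rewrite big_mkcond/= -[RHS]subn0 -(sum_ord_itv 0 (leq_subr i k)).
  apply: eq_bigr => j _; rewrite leq0n ltn_subRL; by case: ifP.
rewrite -(big_mkord xpredT (fun i => k - i)%N) big_nat_rev/= add0n.
rewrite -bin2_sum big_nat_recl//= add0n big_nat [RHS]big_nat.
by apply: eq_bigr => i /andP[_ ik]; lia.
Qed.

(** * Bounds on integrals by sums over cells *)

Section CellsIntegral.
Context d (T : measurableType d) (R : realType) (Pr : probability T R).
Variables (I : finType) (X : I -> {RV Pr >-> R}).
Hypothesis hX_exp : forall i, exponentially_distributed 1 (X i).
Hypothesis hX_ind : mutually_independent X.
Variables (h : R) (Z : T -> \bar R) (G : {ffun I -> nat} -> R).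
Hypothesis h_gt0 : 0 < h.
Hypothesis mZ : measurable_fun setT Z.
Hypothesis Z_ge0 : forall w, (0 <= Z w)%E.

Lemma integral_le_cells : (forall c w, cell X h c w -> (Z w <= (G c)%:E)%E) ->
  (\int[Pr]_w Z w <= \esum_(c in [set: {ffun I -> nat}]) (G c * cell_prob h c)%:E)%E.
Proof.
move=> ZG; rewrite (integral_cells hX_exp hX_ind h_gt0)//; apply: le_esum => c _.
have mc := measurable_cell X h c.
rewrite EFinM -(cell_probE hX_exp hX_ind h_gt0) -integral_cst//.
apply: ge0_le_integral => //; last by move=> w; exact: ZG.
exact: measurable_funS mZ.
Qed.

Lemma integral_ge_cells : (forall c, 0 <= G c) ->
    (forall c w, cell X h c w -> ((G c)%:E <= Z w)%E) ->
  (\esum_(c in [set: {ffun I -> nat}]) (G c * cell_prob h c)%:E <= \int[Pr]_w Z w)%E.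
Proof.
move=> G0 GZ; rewrite (integral_cells hX_exp hX_ind h_gt0)//; apply: le_esum => c _.
have mc := measurable_cell X h c.
rewrite EFinM -(cell_probE hX_exp hX_ind h_gt0) -integral_cst//.
apply: ge0_le_integral => //; last by move=> w; exact: GZ.
- by move=> w _; rewrite lee_fin.
- exact: measurable_funS mZ.
Qed.

End CellsIntegral.

(** Under [cell_prob] the coordinates are independent geometric variables, so the transform factors;
    the coordinates outside [M] contribute 1. *)
Lemma esum_cell_prob_exp (R : realType) (I : finType) (h : R) (M : {set I}) : 0 < h ->
  (\esum_(c in [set: {ffun I -> nat}])
     (expR (- \sum_(i in M) (c i)%:R) * cell_prob h c)%:E =
   (((1 - expR (- h)) / (1 - expR (- h) * expR (- 1))) ^+ #|M|)%:E)%E.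
Proof.
move=> h0; have /andP[q0 q1] := expRN_itv01 h0.
pose r i : R := if i \in M then expR (- 1) else 1.
have r0 i : 0 < r i by rewrite /r; case: ifP => // _; exact: expR_gt0.
have r1 i : r i <= 1 by rewrite /r; case: ifP => // _; rewrite -expR0 ler_expR; lra.
have rq i : `|expR (- h) * r i| < 1.
  rewrite ger0_norm ?mulr_ge0 ?(ltW q0) ?(ltW (r0 i))//.
  by rewrite (le_lt_trans _ q1)// ler_piMr// ltW.
pose f i j : R := (1 - expR (- h)) * (expR (- h) * r i) ^+ j.
transitivity (\esum_(c in [set: {ffun I -> nat}]) (\prod_i f i (c i))%:E)%E.
  apply: eq_esum => c _; congr EFin; rewrite -sumrN expR_sum big_mkcond/=.
  rewrite /cell_prob -big_split/=; apply: eq_bigr => i _.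
  rewrite /f /r exprMn; case: ifP => _; last by rewrite expr1n; ring.
  have -> : expR (- 1) ^+ c i = expR (- (c i)%:R) :> R by rewrite -expRM_natr mulN1r.
  ring.
rewrite (@esum_ffun_prod _ _ f (fun i => (1 - expR (- h)) / (1 - expR (- h) * r i))).
- congr EFin; rewrite -prodr_const [RHS]big_mkcond/=; apply: eq_bigr => i _.
  by rewrite /r; case: ifP => // _; rewrite mulr1 divff// gt_eqF// subr_gt0.
- move=> i j; rewrite /f mulr_ge0 ?exprn_ge0 ?mulr_ge0 ?subr_ge0 ?(ltW q1) ?(ltW q0)//.
  exact/ltW.
- move=> i; apply: esum_nat_cvg => [j|].
    rewrite /f mulr_ge0 ?exprn_ge0 ?mulr_ge0 ?subr_ge0 ?(ltW q1) ?(ltW q0)//.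
    exact/ltW.
  exact: cvg_geometric_series (rq i).
Qed.

(** * The moment generating function *)

Section MatchingMgf.
Context (k m n : nat) (hk : (1 <= k <= minn m n)%N)
    (R : realType) (d : measure_display) (T : measurableType d)
    (Pr : probability T R) (X : 'I_m * 'I_n -> {RV Pr >-> R})
    (hX_exp : forall e, exponentially_distributed 1 (X e))
    (hX_ind : mutually_independent X).
Notation edge := ('I_m * 'I_n)%type.
Notation cover := ({set 'I_m} * {set 'I_n})%type.
Notation gen := (cover + edge)%type.
Let km : (k <= minn m n)%N. Proof. by case/andP: hk. Qed.
Let kn : (k <= n)%N. Proof. by move: km; rewrite leq_min => /andP[]. Qed.
Let C : T -> R := fun w => min_matching_cost k (fun e => X e w).

Lemma measurable_min_cost : measurable_fun setT C.
Proof.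
have [M0 M0k] := exists_k_matching km.
rewrite (_ : C = fun w =>
    \big[Num.min/matching_cost (fun e => X e w) M0]_(M | is_k_matching k M)
      matching_cost (fun e => X e w) M).
  have mcost (M : {set edge}) : measurable_fun setT (fun w => matching_cost (fun e => X e w) M).
    rewrite (_ : (fun w => _) = fun w => \sum_e if e \in M then X e w else 0); last first.
      by apply/funext => w; rewrite /matching_cost big_mkcond.
    apply: measurable_sum => e; case: (e \in M); first exact: measurable_funPT.
    exact: measurable_cst.
  suff mbig s : measurable_fun setT (fun w =>
      \big[Num.min/matching_cost (fun e => X e w) M0]_(M <- s | is_k_matching k M)
        matching_cost (fun e => X e w) M) by exact: mbig.
  elim: s => [|M s IH].
    by under eq_fun do rewrite big_nil; exact: mcost.
  under eq_fun do rewrite big_cons.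
  by case: (is_k_matching k M) => //; exact: measurable_minr.
apply/funext => w; rewrite /C.
have [[M Mk ->] minM] := min_matching_costP (fun e => X e w) km.
apply/eqP; rewrite eq_le; apply/andP; split; last exact: bigmin_le_cond.
by apply: le_bigmin => [|N Nk]; exact: minM.
Qed.

Definition grid_cost (c : edge -> nat) : R := min_matching_cost k (fun e => (c e)%:R).

(** Rounding changes each edge cost by at most [h], and a matching has [k] edges. *)
Lemma min_cost_cell h c w : 0 < h -> cell X h c w ->
  h * grid_cost c <= C w <= h * grid_cost c + k%:R * h.
Proof.
move=> h0 cw.
have Xc e : (c e)%:R * h <= X e w <= (c e)%:R * h + h.
  have := cw e; rewrite /= inE => /(_ isT); rewrite /= in_itv /= => /andP[/ltW -> Xe] /=.
  by rewrite -[X in _ + X]mul1r -mulrDl natr1.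
rewrite /C /grid_cost.
have [[M Mk ->] minM] := min_matching_costP (fun e => X e w) km.
have [[N Nk ->] minN] := min_matching_costP (fun e => (c e)%:R : R) km.
apply/andP; split.
  rewrite (le_trans (ler_wpM2l (ltW h0) (minN M Mk)))// /matching_cost mulr_sumr.
  by apply: ler_sum => e _; rewrite mulrC; have /andP[] := Xc e.
rewrite (le_trans (minM N Nk))// /matching_cost mulr_sumr.
have [<- _ _] := k_matchingP _ _ Nk.
rewrite [#|N|%:R * h]mulr_natl -sumr_const -big_split/=.
by apply: ler_sum => e _; rewrite [h * _]mulrC; have /andP[] := Xc e.
Qed.

Lemma grid_cost_ge (u : {ffun gen -> nat}) : (dual_value k u)%:R <= grid_cost (cost_of u).
Proof.
rewrite /grid_cost; have [[M Mk ->] _] := min_matching_costP (fun e => (cost_of u e)%:R : R) km.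
by rewrite /matching_cost -natr_sum ler_nat dual_value_le.
Qed.

Lemma grid_costE (u : {ffun gen -> nat}) : admissible k (supp u) ->
  grid_cost (cost_of u) = (dual_value k u)%:R.
Proof.
move=> au; apply/eqP; rewrite eq_le grid_cost_ge andbT.
have [M Mk <-] := dual_value_attained kn au.
have [_ minM] := min_matching_costP (fun e => (cost_of u e)%:R : R) km.
by rewrite natr_sum; exact: minM.
Qed.

Lemma mgfE t : 'M_Pr C t = (\int[Pr]_w (expR (t * C w))%:E)%E.
Proof.
by rewrite /mmt_gen_fun unlock; apply: eq_integral => w _; rewrite /= mulrC.
Qed.

Let mexpC t x : measurable_fun setT (fun w => (x * expR (t * C w))%:E).
Proof.
apply/measurable_EFinP; apply: measurable_funM; first exact: measurable_cst.
apply: (measurableT_comp (@measurable_expR R)); apply: measurable_funM; first exact: measurable_cst.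
exact: measurable_min_cost.
Qed.

(** The moment generating function after each edge cost is replaced by the lower end of its
    interval. *)
Definition grid_mgf t h : \bar R :=
  \esum_(c in [set: {ffun edge -> nat}]) (expR (t * (h * grid_cost c)) * cell_prob h c)%:E.

(** Rounding moves the minimum cost by at most [k%:R * h]. The bounds hold in the extended reals, so
    finiteness passes both ways. *)
Lemma grid_mgf_bounds t h : 0 < h ->
  ((expR (- (`|t| * (k%:R * h))))%:E * 'M_Pr C t <= grid_mgf t h <=
   (expR (`|t| * (k%:R * h)))%:E * 'M_Pr C t)%E.
Proof.
move=> h0; rewrite mgfE.
have mC1 : measurable_fun setT (fun w => (expR (t * C w))%:E).
  by have := mexpC t 1; under eq_fun do rewrite mul1r.
have h0' := ltW h0.
have near w c : cell X h c w -> `|t * (C w - h * grid_cost c)| <= `|t| * (k%:R * h).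
  move=> /(min_cost_cell h0)/andP[c1 c2]; rewrite normrM ler_wpM2l//.
  by rewrite ger0_norm ?subr_ge0// lerBlDl.
apply/andP; split.
  rewrite -ge0_integralZl_EFin ?expR_ge0//.
  apply: (integral_le_cells hX_exp hX_ind h0).
  - by have := mexpC t (expR (- (`|t| * (k%:R * h)))).
  - by move=> w; rewrite -EFinM lee_fin mulr_ge0 ?expR_ge0.
  move=> c w /near; rewrite -EFinM lee_fin -expRD ler_expR ler_norml => /andP[_].
  by rewrite mulrBr; lra.
rewrite -ge0_integralZl_EFin ?expR_ge0//.
apply: (integral_ge_cells hX_exp hX_ind h0).
- by have := mexpC t (expR (`|t| * (k%:R * h))).
- by move=> w; rewrite -EFinM lee_fin mulr_ge0 ?expR_ge0.
- by move=> c; exact: expR_ge0.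
move=> c w /near; rewrite -EFinM lee_fin -expRD ler_expR ler_norml => /andP[+ _].
by rewrite mulrBr; lra.
Qed.


(** * Weights of the generators and poles *)

Definition gen_size (g : gen) : nat :=
  match g with inl s => (m - #|s.1|) * (n - #|s.2|) | inr _ => 1 end.

Definition gen_value (g : gen) : nat :=
  match g with inl s => k - #|s.1| - #|s.2| | inr _ => 0 end.

(** Each unit of [g] contributes [gen_size g] to the total cost and [gen_value g] to the minimum
    cost of an admissible combination, hence a factor [expR (- (h * gen_rate t g))] to its
    weight. *)
Definition gen_rate (t : R) (g : gen) : R := (gen_size g)%:R - t * (gen_value g)%:R.

(** Positivity at [t] of all the factors of the denominator; it turns out to be equivalent to
    finiteness of the moment generating function. *)
Definition left_of_poles (t : R) := forall i j, (i + j < k)%N ->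
  t * (k - i - j)%:R < ((m - i) * (n - j))%:R.

Lemma left_of_poles_rate t U g : left_of_poles t -> admissible k U -> g \in U -> 0 < gen_rate t g.
Proof.
move=> rt aU; case: g => [s|e] gU; rewrite /gen_rate /=; last by rewrite mulr0 subr0.
have [sm sn sk] := admissible_card kn aU gU; rewrite subr_gt0.
have [/rt//|ks] := ltnP (#|s.1| + #|s.2|) k.
have -> : (k - #|s.1| - #|s.2| = 0)%N by lia.
by rewrite mulr0 ltr0n muln_gt0 !subn_gt0 sm.
Qed.

Lemma grid_mass (u : {ffun gen -> nat}) (h : R) :
  cell_prob h [ffun e => cost_of u e] = expR (- h * (\sum_g u g * gen_size g)%:R) *
    (1 - expR (- h)) ^+ (m * n).
Proof.
rewrite /cell_prob big_split/= prodr_const card_prod !card_ord; congr (_ * _).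
under eq_bigr do rewrite ffunE -expRM_natr.
rewrite -expR_sum -mulr_sumr -natr_sum total_cost_of big_sumType/=.
by do 2 congr (_ _); congr (_%:R); congr addn; apply: eq_bigr => e _; rewrite muln1.
Qed.

Lemma dual_valueE (u : {ffun gen -> nat}) : dual_value k u = (\sum_g u g * gen_value g)%N.
Proof.
rewrite /dual_value big_sumType/= [X in (_ + X)%N]big1 ?addn0// => e _.
by rewrite muln0.
Qed.

Lemma grid_cost_ffun (u : {ffun gen -> nat}) :
  grid_cost [ffun e => cost_of u e] = grid_cost (cost_of u).
Proof. by congr min_matching_cost; apply/funext => e; rewrite ffunE. Qed.

Lemma expR_gen_weight (t h : R) (u : {ffun gen -> nat}) :
  expR (t * (h * (dual_value k u)%:R)) * expR (- h * (\sum_g u g * gen_size g)%:R) =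
  \prod_g expR (- (h * gen_rate t g)) ^+ u g.
Proof.
under [RHS]eq_bigr do rewrite -expRM_natr.
rewrite -expR_sum -expRD dual_valueE; congr expR.
rewrite !natr_sum 3!mulr_sumr -big_split/=; apply: eq_bigr => g _.
by rewrite /gen_rate !natrM; ring.
Qed.

(** Integer costs correspond bijectively to admissible combinations, whose weights are products over
    the generators; each support then gives geometric series of ratios below 1. *)
Lemma grid_mgfE t h : 0 < h -> left_of_poles t -> grid_mgf t h =
  ((1 - expR (- h)) ^+ (m * n) * \sum_(U : {set gen} | `[< admissible k U >])
     \prod_(g in U) (expR (- (h * gen_rate t g)) / (1 - expR (- (h * gen_rate t g)))))%:E.
Proof.
move=> h0 rt; rewrite /grid_mgf.
pose A : set {ffun gen -> nat} := [set u | `[< admissible k (supp u) >]].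
pose e (u : {ffun gen -> nat}) : {ffun edge -> nat} := [ffun e => cost_of u e].
rewrite (reindex_esum A _ e); last first.
  split=> // [u u' /set_mem/asboolP au /set_mem/asboolP au' /ffunP uu'|c _].
    by apply: (cost_of_inj kn) => // x; have := uu' x; rewrite !ffunE.
  have [u au uc] := cost_of_surj c hk.
  by exists u; [exact/asboolP|apply/ffunP => x; rewrite ffunE uc].
have q1 : 0 < 1 - expR (- h) by rewrite subr_gt0 expRN_lt1.
transitivity (\esum_(u in A) (((1 - expR (- h)) ^+ (m * n))%:E *
    (\prod_g expR (- (h * gen_rate t g)) ^+ u g)%:E))%E.
  apply: eq_esum => u /asboolP au; rewrite -EFinM grid_cost_ffun grid_costE//.
  by rewrite grid_mass mulrA expR_gen_weight mulrC.
rewrite esumZl ?exprn_gt0//; last first.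
  by move=> u; rewrite lee_fin prodr_ge0// => g _; rewrite exprn_ge0// expR_ge0.
rewrite EFinM; congr (_ * _)%E.
apply: (@esum_supp R _ (fun g => expR (- (h * gen_rate t g)))
   (fun U => `[< admissible k U >])) => [g|U g /asboolP aU gU]; first exact: expR_ge0.
by rewrite expRN_lt1// mulr_gt0// (left_of_poles_rate rt aU).
Qed.

Lemma left_of_poles_mgf_lty t : left_of_poles t -> ('M_Pr C t < +oo)%E.
Proof.
move=> rt; have /andP[+ _] := @grid_mgf_bounds t 1 ltr01.
rewrite grid_mgfE// mgfE => H; rewrite ltNge leye_eq; apply/negP => /eqP Moo.
by move: H; rewrite Moo mulry gtr0_sg ?expR_gt0// mul1e.
Qed.

(* Costs supported by an [(m - i) * (n - j)] block already make the sum over the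
   grid diverge at a pole. *)
Lemma mgf_lty_left_of_poles t : ('M_Pr C t < +oo)%E -> left_of_poles t.
Proof.
move=> Mlt i j ij; rewrite ltNge; apply/negP => tb.
have km' : (k <= m)%N by move: km; rewrite leq_min => /andP[].
have a0 : (0 < (m - i) * (n - j))%N by rewrite muln_gt0 !subn_gt0; lia.
have [A cA] : exists A : {set 'I_m}, #|A| = i.
  exists [set x in take i (enum 'I_m)]%SET; rewrite cardsE (card_uniqP _) ?take_uniq ?enum_uniq//.
  by rewrite size_take size_enum_ord; case: ltnP; lia.
have [B cB] : exists B : {set 'I_n}, #|B| = j.
  exists [set x in take j (enum 'I_n)]%SET; rewrite cardsE (card_uniqP _) ?take_uniq ?enum_uniq//.
  by rewrite size_take size_enum_ord; case: ltnP; lia.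
pose g0 : gen := inl (A, B).
pose u N : {ffun gen -> nat} := [ffun g => if g == g0 then N else 0%N].
have sumu N (f : gen -> nat) : (\sum_g u N g * f g = N * f g0)%N.
  rewrite (bigD1 g0)//= big1 ?addn0 => [|g /negPf gg]; first by rewrite ffunE eqxx.
  by rewrite ffunE gg mul0n.
pose e N : {ffun edge -> nat} := [ffun x => cost_of (u N) x].
have totE N : (\sum_x e N x = N * ((m - i) * (n - j)))%N.
  under eq_bigr do rewrite ffunE; rewrite total_cost_of.
  have := sumu N gen_size; rewrite big_sumType/= cA cB => <-; congr addn.
  by apply: eq_bigr => x _; rewrite muln1.
have e_inj : set_inj [set: nat] e.
  move=> N N' _ _ NN'; have := totE N; rewrite NN' totE => /eqP.
  by rewrite eqn_pmul2r// => /eqP.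
(* The combinations used here need not be admissible, so only a lower bound on their grid cost is at
   hand; multiplying it by [t] requires this sign. *)
have t0 : 0 <= t.
  have b0 : 0 < (k - i - j)%:R :> R by rewrite ltr0n; lia.
  by rewrite -(pmulr_lge0 _ b0) (le_trans _ tb).
have q1 : 0 < 1 - expR (- 1 : R) by rewrite subr_gt0 expRN_lt1.
have Soo : grid_mgf t 1 = +oo%E.
  apply/eqP; rewrite -leye_eq.
  apply: (@le_trans _ _ (\esum_(c in range e) (expR (t * (1 * grid_cost c)) * cell_prob 1 c)%:E)%E);
    last exact: subset_esum.
  rewrite esum_image//.
  pose w := expR (- (1 * gen_rate t g0)).
  apply: (@le_trans _ _ (\esum_(N in [set: nat]) (((1 - expR (- 1)) ^+ (m * n))%:E * (w ^+ N)%:E))%E).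
    rewrite esumZl ?exprn_gt0//; last by move=> N; rewrite lee_fin exprn_ge0// expR_ge0.
    rewrite esum_geometric_infty; first by rewrite gt0_muley ?leey// lte_fin exprn_gt0.
    rewrite /w -[leLHS]expR0 ler_expR mul1r oppr_ge0 /gen_rate /= cA cB subr_le0.
    exact: tb.
  apply: le_esum => N _; rewrite -EFinM lee_fin grid_cost_ffun grid_mass mulrA mulrC.
  rewrite ler_wpM2r ?exprn_ge0 ?(ltW q1)//.
  have -> : w ^+ N = \prod_g expR (- (1 * gen_rate t g)) ^+ u N g.
    rewrite (bigD1 g0)//= big1 ?mulr1 => [|g /negPf gg]; first by rewrite ffunE eqxx.
    by rewrite ffunE gg expr0.
  rewrite -expR_gen_weight ler_wpM2r ?expR_ge0// ler_expR !mul1r ler_wpM2l//.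
  exact: grid_cost_ge.
have /andP[_] := @grid_mgf_bounds t 1 ltr01.
apply/negP; rewrite Soo -ltNge; apply: lte_mul_pinfty => //.
Qed.


(** * Passage to the limit in the mesh *)

Lemma onem_expRN_bounds (x : R) : 0 < x -> x / (1 + x) <= 1 - expR (- x) <= x.
Proof.
move=> x0; apply/andP; split; last by have := expR_ge1Dx (- x); lra.
have x1 : 0 < 1 + x by lra.
have -> : x / (1 + x) = 1 - (1 + x)^-1 by field; lra.
by rewrite lerD2l lerN2 expRN lef_pV2 ?posrE ?expR_gt0// expR_ge1Dx.
Qed.

Let hs (j : nat) : R := j.+1%:R^-1.
Let hs_gt0 j : 0 < hs j. Proof. by rewrite invr_gt0 ltr0n. Qed.
Let hs_cvg : hs @ \oo --> (0 : R). Proof. exact: cvg_harmonic. Qed.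

Let hsM_cvg (r : R) : (fun j => hs j * r) @ \oo --> (0 : R).
Proof. by rewrite -[X in _ --> X](mul0r r); apply: cvgM => //; exact: cvg_cst. Qed.

Let expR_cvg0 (f : nat -> R) : f @ \oo --> (0 : R) -> (fun j => expR (f j)) @ \oo --> (1 : R).
Proof.
move=> f0; rewrite -expR0; apply: (@cvg_comp _ _ _ f expR \oo (nbhs (0 : R)) _ f0).
exact: continuous_expR.
Qed.

Let expR_hs_cvg (r : R) : (fun j => expR (- (hs j * r))) @ \oo --> (1 : R).
Proof. by apply: expR_cvg0; rewrite -oppr0; apply: cvgN; exact: hsM_cvg. Qed.

Let slope_cvg (r : R) : 0 < r ->
  (fun j => (1 - expR (- (hs j * r))) / (hs j * r)) @ \oo --> (1 : R).
Proof.
move=> r0; apply: (@squeeze_cvgr _ _ _ _ (fun j => (1 + hs j * r)^-1) (cst 1)).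
- apply: nearW => j; have x0 : 0 < hs j * r by rewrite mulr_gt0.
  have /andP[l1 l2] := onem_expRN_bounds x0.
  by rewrite ler_pdivlMr// mulrC l1/= ler_pdivrMr// mul1r.
- rewrite -[X in _ --> X]invr1; apply: cvgV => //.
  by rewrite -[X in _ --> X]addr0; apply: cvgD; [exact: cvg_cst|exact: hsM_cvg].
- exact: cvg_cst.
Qed.

Let factor_cvg (r : R) : 0 < r -> (fun j => (1 - expR (- hs j)) *
    (expR (- (hs j * r)) / (1 - expR (- (hs j * r))))) @ \oo --> r^-1.
Proof.
move=> r0; rewrite (_ : (fun j => _) = fun j =>
    (1 - expR (- (hs j * 1))) / (hs j * 1) * expR (- (hs j * r)) *
    ((1 - expR (- (hs j * r))) / (hs j * r))^-1 * r^-1); last first.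
  apply/funext => j; rewrite mulr1.
  have x0 : 0 < hs j * r by rewrite mulr_gt0.
  have := expRN_lt1 x0; have := hs_gt0 j; set w := expR (- (hs j * r)).
  set q := expR (- hs j); move: (hs j) => h h0 w1.
  field; lra.
have e : 1 * 1 * 1^-1 * r^-1 = r^-1 by rewrite invr1 !mul1r.
rewrite -[X in _ --> X]e.
apply: cvgM; last exact: cvg_cst.
apply: cvgM; last by apply: cvgV; [exact: oner_neq0|exact: slope_cvg].
by apply: cvgM; [exact: slope_cvg ltr01|exact: expR_hs_cvg].
Qed.

(** The cones of full dimension, each inverse rate being the limit of one geometric series scaled by
    [1 - expR (- h)]. *)
Definition mgf_value t : R :=
  \sum_(U : {set gen} | `[< admissible k U >] && (#|U| == m * n)%N)
    \prod_(g in U) (gen_rate t g)^-1.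

(** Along the meshes [hs j] the grid sums are squeezed towards the moment generating function, while
    their limit is computed support by support. *)
Lemma mgf_limit t : left_of_poles t -> 'M_Pr C t = (mgf_value t)%:E.
Proof.
move=> rt; have Mlt := left_of_poles_mgf_lty rt.
have M0 : (0 <= 'M_Pr C t)%E.
  by rewrite mgfE; apply: integral_ge0 => w _; rewrite lee_fin expR_ge0.
have Mfin : 'M_Pr C t \is a fin_num by rewrite ge0_fin_numE.
rewrite -(fineK Mfin); set r := fine _; congr EFin.
pose H j := (1 - expR (- hs j)) ^+ (m * n) * \sum_(U : {set gen} | `[< admissible k U >])
  \prod_(g in U) (expR (- (hs j * gen_rate t g)) / (1 - expR (- (hs j * gen_rate t g)))).
have Hb j : expR (- (`|t| * (k%:R * hs j))) * r <= H j <= expR (`|t| * (k%:R * hs j)) * r.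
  have := grid_mgf_bounds t (hs_gt0 j).
  by rewrite grid_mgfE// -(fineK Mfin) -!EFinM !lee_fin.
have ecvg (x : R) : (fun j => expR (x * hs j) * r) @ \oo --> r.
  rewrite -[X in _ --> X]mul1r; apply: cvgM; last exact: cvg_cst.
  by apply: expR_cvg0; under eq_fun do rewrite mulrC; exact: hsM_cvg.
have q0 : (fun j => 1 - expR (- hs j)) @ \oo --> (0 : R).
  rewrite -[X in _ --> X](subrr 1); apply: cvgB; first exact: cvg_cst.
  by have := @expR_hs_cvg 1; under eq_fun do rewrite mulr1.
have Hcvg : H @ \oo --> mgf_value t.
  rewrite /H /mgf_value big_mkcondr/=.
  under eq_fun do rewrite mulr_sumr.
  apply: cvg_big => [|U /asboolP aU]; first exact: add_continuous.
  have Ucard := admissible_dim kn aU.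
  (* One of the [m * n] factors [1 - expR (- hs j)] goes to each generator of [U]; if any is left
     over, the term tends to 0. *)
  have fE : (fun j => (1 - expR (- hs j)) ^+ (m * n) * \prod_(g in U)
      (expR (- (hs j * gen_rate t g)) / (1 - expR (- (hs j * gen_rate t g))))) =
    (fun j => (1 - expR (- hs j)) ^+ (m * n - #|U|) * \prod_(g in U) ((1 - expR (- hs j)) *
      (expR (- (hs j * gen_rate t g)) / (1 - expR (- (hs j * gen_rate t g)))))).
    apply/funext => j; rewrite [in RHS]big_split/= prodr_const mulrA -exprD.
    by rewrite subnK.
  rewrite fE; have pcvg : (fun j => \prod_(g in U) ((1 - expR (- hs j)) *
      (expR (- (hs j * gen_rate t g)) / (1 - expR (- (hs j * gen_rate t g))))))
      @ \oo --> \prod_(g in U) (gen_rate t g)^-1.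
    apply: cvg_big => [|g gU]; first exact: mul_continuous.
    by apply: factor_cvg; exact: left_of_poles_rate gU.
  case: ifPn => [/eqP ->|UD].
    by rewrite subnn; under eq_fun do rewrite expr0 mul1r.
  have : (0 < m * n - #|U|)%N by rewrite subn_gt0 ltn_neqAle UD.
  case: (m * n - #|U|)%N => // N _.
  have qX i : (fun j => (1 - expR (- hs j)) ^+ i) @ \oo --> (0 : R) ^+ i.
    elim: i => [|i IH]; first by under eq_fun do rewrite expr0; exact: cvg_cst.
    by rewrite exprS; under eq_fun do rewrite exprS; exact: cvgM.
  rewrite -[X in _ --> X](mul0r (\prod_(g in U) (gen_rate t g)^-1)); apply: cvgM => //.
  by have := qX N.+1; rewrite expr0n.
apply/eqP; rewrite eq_le; apply/andP; split.
  apply: (ler_cvg_to (ecvg (- (`|t| * k%:R))) Hcvg); apply: nearW => j.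
  by have /andP[+ _] := Hb j; rewrite mulNr mulrA.
apply: (ler_cvg_to Hcvg (ecvg (`|t| * k%:R))); apply: nearW => j.
by have /andP[_ +] := Hb j; rewrite mulrA.
Qed.


(** * Decay at minus infinity *)

Let decay (s : R) := (1 - expR (- s^-1)) / (1 - expR (- s^-1) * expR (- 1)).

Lemma grid_cost_le (c : edge -> nat) M : is_k_matching k M ->
  grid_cost c <= \sum_(e in M) (c e)%:R.
Proof.
by move=> Mk; have [_] := min_matching_costP (fun e => (c e)%:R : R) km; exact.
Qed.

(** At mesh [s^-1] the exponent is minus the integer grid cost, and [decay s ^+ k] is the transform
    of the cost of one fixed matching. A single matching gives the lower bound, the sum over all
    matchings the upper one. *)
Lemma grid_mgf_neg_bounds (s : R) : 0 < s ->
  ((decay s ^+ k)%:E <= grid_mgf (- s) s^-1 <= ((#|{: {set edge}}|%:R) * decay s ^+ k)%:E)%E.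
Proof.
move=> s0; have s0' : 0 < s^-1 by rewrite invr_gt0.
have gE : grid_mgf (- s) s^-1 =
    (\esum_(c in [set: {ffun edge -> nat}]) (expR (- grid_cost c) * cell_prob s^-1 c)%:E)%E.
  by apply: eq_esum => c _; rewrite mulNr mulrA divff ?mul1r// gt_eqF.
have cp0 (c : {ffun edge -> nat}) : 0 <= cell_prob s^-1 c.
  by have := cell_prob_ge0 hX_exp hX_ind s0' c.
have EM M : is_k_matching k M -> (\esum_(c in [set: {ffun edge -> nat}])
     (expR (- \sum_(i in M) (c i)%:R) * cell_prob s^-1 c)%:E = (decay s ^+ k)%:E)%E.
  by move=> Mk; have [cM _ _] := k_matchingP _ _ Mk; rewrite esum_cell_prob_exp// cM.
rewrite gE; apply/andP; split.
  have [M Mk] := exists_k_matching km; rewrite -(EM M Mk).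
  apply: le_esum => c _; rewrite lee_fin ler_wpM2r// ler_expR lerN2.
  exact: grid_cost_le.
apply: (@le_trans _ _ (\esum_(c in [set: {ffun edge -> nat}])
  \sum_(M : {set edge} | is_k_matching k M)
    (expR (- \sum_(i in M) (c i)%:R) * cell_prob s^-1 c)%:E)%E).
  apply: le_esum => c _.
  have [[M Mk mE] _] := min_matching_costP (fun e => (c e)%:R : R) km.
  rewrite /grid_cost mE (bigD1 M)//= leeDl// sume_ge0// => N _.
  by rewrite lee_fin mulr_ge0// expR_ge0.
rewrite esum_sum => [|c M _ _]; last by rewrite lee_fin mulr_ge0// expR_ge0.
rewrite (eq_bigr _ EM) sumEFin lee_fin sumr_const -[X in X <= _]mulr_natl.
have d0 : 0 <= decay s.
  have /andP[q0 q1] := expRN_itv01 s0'.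
  rewrite divr_ge0 ?subr_ge0 ?(ltW q1)//.
  by rewrite (le_trans _ (ltW q1))// ler_piMr ?(ltW q0)// -expR0 ler_expR; lra.
by rewrite ler_wpM2r ?exprn_ge0// ler_nat max_card.
Qed.

(** The numerator of [decay s] lies between [1 / (s + 1)] and [1 / s], its denominator between
    [1 - expR (- 1)] and 1. *)
Lemma decay_bounds (s : R) : 1 <= s -> 1 / 2 <= s * decay s <= (1 - expR (- 1))^-1.
Proof.
move=> s1; have s0 : 0 < s by lra.
have s0' : 0 < s^-1 by rewrite invr_gt0.
have /andP[q0 q1] := expRN_itv01 s0'.
have /andP[l1 l2] := onem_expRN_bounds s0'.
have e1 : 0 < 1 - expR (- 1 : R) by rewrite subr_gt0 expRN_lt1.
have e0 : 0 < expR (- 1 : R) by exact: expR_gt0.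
rewrite /decay; move: l1 l2 q0 q1; set q := expR (- s^-1); set r := expR (- 1) in e0 e1 *.
move=> l1 l2 q0 q1.
have qr : 0 < 1 - q * r by nra.
have sV : s * s^-1 = 1 by rewrite divff// gt_eqF.
apply/andP; split.
  have h1 : 1 / 2 <= s * (1 - q).
    have : s * (s^-1 / (1 + s^-1)) <= s * (1 - q) by rewrite ler_wpM2l// ltW.
    rewrite mulrA sV; apply: le_trans; rewrite !mul1r lef_pV2 ?posrE; try lra.
    have : s^-1 <= 1 by rewrite invf_le1.
    lra.
  by rewrite mulrA ler_pdivlMr//; nra.
rewrite mulrA ler_pdivrMr//; apply: (@le_trans _ _ 1).
  by rewrite -[leRHS]sV ler_wpM2l// ltW.
by rewrite mulrC ler_pdivlMr// mul1r; nra.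
Qed.

Lemma left_of_poles_neg (t : R) : t <= 0 -> left_of_poles t.
Proof.
move=> t0 i j ij; have km' : (k <= m)%N by move: km; rewrite leq_min => /andP[].
apply: (@le_lt_trans _ _ 0); first by rewrite mulr_le0_ge0.
by rewrite ltr0n muln_gt0 !subn_gt0; lia.
Qed.

(** At [t = - s] and mesh [s^-1] rounding costs only a constant factor [expR k%:R], so the order
    [s ^- k] of the grid sums is inherited. *)
Lemma mgf_value_growth : exists c1 c2 : R, [/\ 0 < c1, 0 < c2 & forall s, 1 <= s ->
  c1 <= mgf_value (- s) * s ^+ k <= c2].
Proof.
pose N : R := #|{: {set edge}}|%:R.
have N0 : 0 < N by rewrite ltr0n; apply/card_gt0P; exists [set: edge]%SET.
have e1 : 0 < 1 - expR (- 1 : R) by rewrite subr_gt0 expRN_lt1.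
exists (expR (- k%:R) * (1 / 2) ^+ k), (expR k%:R * (N * ((1 - expR (- 1))^-1) ^+ k)).
split=> [||s s1].
- by rewrite mulr_gt0 ?expR_gt0 ?exprn_gt0//; lra.
- by rewrite !mulr_gt0 ?expR_gt0 ?exprn_gt0 ?invr_gt0.
have s0 : 0 < s by lra.
have s0' : 0 < s^-1 by rewrite invr_gt0.
have sk : `|- s| * (k%:R * s^-1) = k%:R.
  by rewrite normrN gtr0_norm// mulrCA divff ?mulr1// gt_eqF.
have := grid_mgf_bounds (- s) s0'; rewrite sk mgf_limit; last by apply: left_of_poles_neg; lra.
have := grid_mgf_neg_bounds s0.
move=> /andP[d1 d2] /andP[m1 m2].
have := le_trans d1 m2; have := le_trans m1 d2; rewrite -!EFinM !lee_fin -/N.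
move=> {d1 d2 m1 m2} h2 h1; have /andP[b1 b2] := decay_bounds s1.
have b0 : 0 <= s * decay s by lra.
have ek : expR k%:R * expR (- k%:R) = 1 :> R by rewrite expRN divff// gt_eqF// expR_gt0.
have sk0 : 0 <= s ^+ k by rewrite exprn_ge0// ltW.
have h1' : (s * decay s) ^+ k <= expR k%:R * (mgf_value (- s) * s ^+ k).
  by rewrite exprMn mulrA mulrC ler_wpM2r.
have h2' : expR (- k%:R) * (mgf_value (- s) * s ^+ k) <= N * (s * decay s) ^+ k.
  by rewrite exprMn mulrA [s ^+ k * _]mulrC [leRHS]mulrA ler_wpM2r.
apply/andP; split.
  have -> : mgf_value (- s) * s ^+ k =
      expR (- k%:R) * (expR k%:R * (mgf_value (- s) * s ^+ k)).
    by rewrite mulrA [expR (- _) * _]mulrC ek mul1r.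
  rewrite ler_wpM2l ?expR_ge0// (le_trans _ h1')// lerXn2r// ?nnegrE//; lra.
have -> : mgf_value (- s) * s ^+ k =
    expR k%:R * (expR (- k%:R) * (mgf_value (- s) * s ^+ k)).
  by rewrite mulrA ek mul1r.
rewrite ler_wpM2l ?expR_ge0// (le_trans h2')//.
by rewrite ler_wpM2l ?(ltW N0)// lerXn2r// ?nnegrE// invr_ge0 ltW.
Qed.

End MatchingMgf.

(** * Numerator and denominator *)

Section Polynomials.
Variables (R : realType) (m n k : nat).
Hypothesis hk : (1 <= k <= minn m n)%N.
Notation cover := ({set 'I_m} * {set 'I_n})%type.
Notation gen := (cover + 'I_m * 'I_n)%type.
Let km : (k <= m)%N. Proof. by move: hk; lia. Qed.
Let kn : (k <= n)%N. Proof. by move: hk; lia. Qed.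

Definition pole_factor (i j : nat) : {poly R} :=
  1 - ((k - i - j)%:R / ((m - i)%:R * (n - j)%:R)) *: 'X.

Lemma mgf_denominator_pair : mgf_denominator R m n k =
  \prod_(p : 'I_k * 'I_k | (p.1 + p.2 < k)%N) pole_factor p.1 p.2.
Proof. by rewrite /mgf_denominator pair_big_dep. Qed.

Lemma size_pole_factor i j : (i + j < k)%N -> size (pole_factor i j) = 2.
Proof.
move=> ij; rewrite /pole_factor addrC size_polyDl;
  rewrite size_polyN size_scale ?size_polyX ?size_poly1//.
all: by rewrite mulf_neq0 ?invr_eq0 ?mulf_neq0// pnatr_eq0; lia.
Qed.

Lemma size_mgf_denominator : size (mgf_denominator R m n k) = 'C(k.+1, 2).+1.
Proof.
rewrite mgf_denominator_pair size_prod => [|p /size_pole_factor sp]; last first.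
  by rewrite -size_poly_gt0 sp.
rewrite (eq_bigr (fun=> 2%N)) => [|p /size_pole_factor//].
rewrite sum_nat_const -(card_lt_diag k); set c := #|_|; lia.
Qed.

Lemma pole_factor_gt0 t i j : left_of_poles k m n t -> (i + j < k)%N -> 0 < (pole_factor i j).[t].
Proof.
move=> rt ij; rewrite /pole_factor !hornerE subr_gt0 mulrAC -natrM.
rewrite ltr_pdivrMr ?mul1r; first by rewrite mulrC; exact: rt.
by rewrite ltr0n muln_gt0 !subn_gt0; lia.
Qed.

Lemma mgf_denominator_gt0 t : left_of_poles k m n t -> 0 < (mgf_denominator R m n k).[t].
Proof.
move=> rt; rewrite mgf_denominator_pair horner_prod; apply: prodr_gt0 => p.
exact: pole_factor_gt0.
Qed.

Let origin : 'I_k. Proof. by exists 0%N; case/andP: hk. Defined.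

(** The sizes of a polar cover are below [k]; [origin] is the default for sizes that are not. *)
Definition cover_size (s : cover) : 'I_k * 'I_k := (insubd origin #|s.1|, insubd origin #|s.2|).

(** In an admissible support the remaining covers have sizes adding up to [k], hence a rate
    independent of [t] and no pole. *)
Definition polar_covers (U : {set gen}) : {set cover} :=
  [set s | (inl s \in U) && (#|s.1| + #|s.2| < k)%N].

Lemma cover_sizeE U s : s \in polar_covers U ->
  ((cover_size s).1 = #|s.1| :> nat) * ((cover_size s).2 = #|s.2| :> nat).
Proof.
rewrite inE => /andP[_ sk]; rewrite /cover_size /= !val_insubd.
by rewrite (leq_ltn_trans (leq_addr _ _) sk) (leq_ltn_trans (leq_addl _ _) sk).
Qed.

(** The factors of the denominator that the cone of [U] lacks. *)
Definition simplex_numerator (U : {set gen}) : {poly R} :=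
  \prod_(p : 'I_k * 'I_k | (p.1 + p.2 < k)%N && (p \notin cover_size @: polar_covers U))
    pole_factor p.1 p.2.

(** The polar covers of an admissible support have distinct pairs of sizes, so their factors form a
    subproduct of the denominator. *)
Lemma simplex_denominator U : admissible k U -> mgf_denominator R m n k =
  \prod_(s in polar_covers U) pole_factor #|s.1| #|s.2| * simplex_numerator U.
Proof.
move=> aU; rewrite mgf_denominator_pair (bigID (mem (cover_size @: polar_covers U)))/=.
congr (_ * _); rewrite (eq_bigl (mem (cover_size @: polar_covers U))); last first.
  move=> p; rewrite andbC -[RHS]/(p \in _); case: (boolP (p \in _)) => //= /imsetP[s sU ->].
  by rewrite !(cover_sizeE sU); move: sU; rewrite inE => /andP[].
rewrite big_imset/=; last first.
  move=> s s' sU sU' ss'; have := cover_sizeE sU; have := cover_sizeE sU'; rewrite ss'.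
  move=> [-> ->] [c1 c2]; move: sU sU'; rewrite !inE => /andP[sU _] /andP[sU' _].
  exact: (admissible_card_inj aU sU sU').
by apply: eq_bigr => s sU; rewrite !(cover_sizeE sU).
Qed.

(** Each rate is its value [gen_size g] at 0 times its pole factor, or is constant in [t]. *)
Lemma prod_gen_rate t U : admissible k U ->
  \prod_(g in U) gen_rate k t g = \prod_(g in U) (gen_size g)%:R *
    (\prod_(s in polar_covers U) pole_factor #|s.1| #|s.2|).[t].
Proof.
move=> aU; rewrite horner_prod.
pose fac (g : gen) : R := match g with
  | inl s => if (#|s.1| + #|s.2| < k)%N then (pole_factor #|s.1| #|s.2|).[t] else 1
  | inr _ => 1 end.
transitivity (\prod_(g in U) ((gen_size g)%:R * fac g)).
  apply: eq_bigr => -[s|e] gU; rewrite /gen_rate /=; last by rewrite mulr0 subr0 mulr1.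
  have [sm sn sk] := admissible_card kn aU gU.
  case: ltnP => sk'.
    have a1 : (m - #|s.1|)%:R != 0 :> R by rewrite pnatr_eq0 -lt0n subn_gt0.
    have a2 : (n - #|s.2|)%:R != 0 :> R by rewrite pnatr_eq0 -lt0n subn_gt0.
    by rewrite /pole_factor !hornerE natrM; field; rewrite a1 a2.
  have -> : (k - #|s.1| - #|s.2| = 0)%N by apply/eqP; rewrite -subnDA subn_eq0.
  by rewrite mulr0 subr0 mulr1.
rewrite big_split/=; congr (_ * _).
rewrite big_mkcond big_sumType/= [X in _ * X]big1 ?mulr1; last by move=> e _; case: ifP.
rewrite [RHS]big_mkcond; apply: eq_bigr => s _; rewrite inE.
by case: (inl s \in U).
Qed.

Definition mgf_numerator : {poly R} :=
  \sum_(U : {set gen} | `[< admissible k U >] && (#|U| == m * n)%N)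
    (\prod_(g in U) (gen_size g)%:R)^-1 *: simplex_numerator U.

Lemma mgf_numeratorE t : left_of_poles k m n t ->
  mgf_value k m n t * (mgf_denominator R m n k).[t] = mgf_numerator.[t].
Proof.
move=> rt; rewrite /mgf_value mulr_suml horner_sum; apply: eq_bigr => U /andP[/asboolP aU _].
rewrite prodfV prod_gen_rate// {1}(simplex_denominator aU) hornerM hornerZ.
set a := \prod_(g in U) _; set b := (\prod_(s in _) _).[t].
have b0 : b != 0.
  rewrite /b horner_prod gt_eqF// prodr_gt0// => s; rewrite inE => /andP[_].
  exact: pole_factor_gt0.
have a0 : a != 0.
  rewrite /a gt_eqF// prodr_gt0// => -[s|e] gU; rewrite ltr0n //=.
  by have [sm sn sk] := admissible_card kn aU gU; rewrite muln_gt0 !subn_gt0 sm.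
by field; rewrite a0.
Qed.

(** By the growth bounds the numerator at [- s] times [s ^+ k] and the denominator at [- s] bound
    each other up to constants, so they have the same degree; and ['C(k.+1, 2) = 'C(k, 2) + k]. *)
Lemma size_mgf_numerator (c1 c2 : R) : 0 < c1 -> 0 < c2 ->
    (forall s, 1 <= s -> c1 <= mgf_value k m n (- s) * s ^+ k <= c2) ->
    (forall s : R, 1 <= s -> left_of_poles k m n (- s)) ->
  size mgf_numerator = 'C(k, 2).+1.
Proof.
move=> c10 c20 bnd reg.
pose A := (mgf_numerator \Po (- 'X)) * 'X^k.
pose B := mgf_denominator R m n k \Po (- 'X).
have sX : size (- 'X : {poly R}) = 2 by rewrite size_polyN size_polyX.
have AE s : 1 <= s -> A.[s] = mgf_value k m n (- s) * s ^+ k * B.[s].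
  move=> s1; rewrite /A /B !(hornerE, horner_comp) -(mgf_numeratorE (reg s s1)).
  ring.
have B0 s : 1 <= s -> 0 < B.[s].
  by move=> s1; rewrite /B !(hornerE, horner_comp) mgf_denominator_gt0//; exact: (reg s s1).
have sAB : size A = size B.
  apply/eqP; rewrite eqn_leq; apply/andP; split.
    apply: (@leq_size_poly_growth _ _ _ c2 1) => // s s1; rewrite AE//.
    have /andP[b1 b2] := bnd s s1; have := B0 s s1 => b0.
    by rewrite mulr_ge0 ?(ltW b0) ?(le_trans (ltW c10))//= ler_wpM2r// ltW.
  apply: (@leq_size_poly_growth _ _ _ c1^-1 1); rewrite ?invr_gt0// => s s1; rewrite AE//.
  have /andP[b1 b2] := bnd s s1; have := B0 s s1 => b0.
  by rewrite (ltW b0) mulrA ler_peMl ?(ltW b0)//= ler_pdivlMl// mulr1.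
have num0 : mgf_numerator != 0.
  apply/eqP => num0; have := AE 1 (lexx _); rewrite /A num0 comp_poly0 mul0r horner0.
  have := B0 1 (lexx _); have /andP[b1 _] := bnd 1 (lexx _) => b0 /esym/eqP.
  by rewrite mulf_eq0 !gt_eqF// (lt_le_trans c10).
have := sAB; rewrite /A /B size_mulXn ?size_comp_poly2//; last first.
  by rewrite -size_poly_gt0 size_comp_poly2// size_poly_gt0.
by rewrite size_mgf_denominator binS bin1 addnC -addSn => /addIn.
Qed.

End Polynomials.

Theorem proposition9 (k m n : nat) (hk : (1 <= k <= minn m n)%N)
    (R : realType) (d : measure_display) (T : measurableType d)
    (Pr : probability T R) (X : 'I_m * 'I_n -> {RV Pr >-> R})
    (hX_exp : forall e, exponentially_distributed 1 (X e))
    (hX_ind : mutually_independent X) :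
  let C : T -> R := fun w => min_matching_cost k (fun e => X e w) in
  (\forall t \near (0 : R), ('M_Pr C t < +oo)%E) /\
  exists P Q : {poly R},
    [/\ size P = ('C(k, 2)).+1,
        size Q = ('C(k.+1, 2)).+1,
        Q = mgf_denominator R m n k &
        forall t : R, ('M_Pr C t < +oo)%E ->
          'M_Pr C t = (P.[t] / Q.[t])%:E].
Proof.
move=> C; split.
  have /andP[k_gt0 _] := hk; have kr : 0 < k%:R :> R by rewrite ltr0n.
  have k0 : 0 < (k%:R)^-1 :> R by rewrite invr_gt0.
  (* Below [1 / k] there is no pole: for [t > 0], [t * (k - i - j) <= t * k < 1 <= (m - i) * (n -
     j)]. *)
  apply: filterS (lt_nbhsl k0) => t tk; apply: (left_of_poles_mgf_lty hk hX_exp hX_ind) => i j ij.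
  have [t0|t0] := leP t 0; first exact: (left_of_poles_neg hk).
  apply: (@le_lt_trans _ _ (t * k%:R)); first by rewrite ler_wpM2l ?ler_nat ?(ltW t0)//; lia.
  apply: (@lt_le_trans _ _ 1).
    by rewrite -ltr_pdivlMr// div1r.
  by rewrite ler1n muln_gt0 !subn_gt0; have := hk; lia.
have [c1 [c2 [c10 c20 bnd]]] := mgf_value_growth hk hX_exp hX_ind.
exists (mgf_numerator R hk), (mgf_denominator R m n k); split=> //.
- apply: (size_mgf_numerator hk c10 c20 bnd) => s s1.
  by apply: (left_of_poles_neg hk); lra.
- exact: size_mgf_denominator.
- move=> t /(mgf_lty_left_of_poles hk hX_exp hX_ind) rt.
  rewrite (mgf_limit hk hX_exp hX_ind rt) -(mgf_numeratorE hk rt) mulfK//.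
  by rewrite gt_eqF// (mgf_denominator_gt0 hk).
Qed.
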